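(* Let $\mathcal{A}$ be a (strict) tensor $C^*$-category closed under projections, direct sums and conjugation, and let $\lambda=(\lambda,T,T^*,S,S^* )$ be a Frobenius algebra in $\mathcal{A}$. Let $\mathcal{E}_0$ be the almost-2-category associated with $\lambda$, described in the context. Then its completion $\mathcal{E}=\mathcal{E}_0^P$ under projections is a bicategory such that: (1) $\mathrm{Obj}\,\mathcal{E}=\{A,B\}$. (2) There is a fully faithful tensor functor $I:\mathcal{A}\to HOM_{\mathcal{E}}(A,A)$ such that for every $Y\in HOM_{\mathcal{E}}(A,A)$ there is $X\in\mathcal{A}$ such that $Y$ is a retract (i.e. sub-1-arrow) of $I(X)$. (3) There are 1-arrows $\rho:B\leftarrow A$ and $\bar\rho:A\leftarrow B$ and 2-arrows $e_\rho:\iota_B\to\rho\otimes\bar\rho$, $\varepsilon_\rho:\iota_A\to\bar\rho\otimes\rho$, $d_\rho:\bar\rho\otimes\rho\to\iota_A$, $\eta_\rho:\rho\otimes\bar\rho\to\iota_B$ satisfying the conjugation (i.e. duality) relations. (4) There is the identity $I(\lambda,T,T^*,S,S^* )=(\bar\rho\otimes\rho,\ \varepsilon_\rho,\ d_\rho,\ 1_{\bar\rho}\otimes e_\rho\otimes1_\rho,\ 1_{\bar\rho}\otimes\eta_\rho\otimes1_\rho)$ of Frobenius algebras in $HOM_{\mathcal{E}}(A,A)$. (5) $\mathcal{E}$ is a preadditive 2-category. (6) $\mathcal{E}$ has direct sums of 1-arrows. Moreover, isomorphic Frobenius algebras $\lambda,\tilde\lambda$ give rise to isomorphic bicategories $\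mathcal{E},\tilde{\mathcal{E}}$.
   Context: A tensor $C^*$-category is a strict tensor category (tensor product $\otimes$, unit $\iota$, not assumed simple) in which every $\mathrm{Hom}(\rho,\sigma)$ is a complex Banach space, $\circ,\otimes$ are bilinear, and there is an antilinear involution $*:\mathrm{Hom}(\rho,\sigma)\to\mathrm{Hom}(\sigma,\rho)$ with $(S\circ T)^*=T^*\circ S^*$, $(S\otimes T)^*=S^*\otimes T^*$, $\|T\circ S\|\le\|T\|\|S\|$, $\|S^*\circ S\|=\|S\|^2$, $S^*\circ S$ positive. Closed under projections: every projection $P\in\mathrm{End}(\rho)$ is $W\circ W^*$ for an isometry $W\in\mathrm{Hom}(\rho_P,\rho)$; direct sums of objects exist, given by isometries; closed under conjugation: for each $\rho$ there are $\bar\rho$, $R\in\mathrm{Hom}(\iota,\bar\rho\otimes\rho)$, $\bar R\in\mathrm{Hom}(\iota,\rho\otimes\bar\rho)$ with $(\bar R^*\otimes1_\rho)\circ(1_\rho\otimes R)=1_\rho$, $(R^*\otimes1_{\bar\rho})\circ(1_{\bar\rho}\otimes\bar R)=1_{\bar\rho}$. Convention: $\otimes$ takes precedence over $\circ$; $\lambda^2=\lambda\otimes\lambda$. A Frobenius algebra in a strict tensor category is a quintuple $(\lambda,V,V',W,W')$ with $V:\iota\to\lambda$, $V':\lambda\to\iota$, $W:\lambda\to\lambda^2$, $W':\lambda^2\to\lambda$ such that $W\otimes1_\lambda\circ W=1_\lambda\otimes W\circ W$; $W'\circ W'\otimes1_\lambda=W'\circ1_\lambda\otimes W'$; $V'\otimes1_\lambda\circ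 W=1_\lambda=1_\lambda\otimes V'\circ W$; $W'\circ V\otimes1_\lambda=1_\lambda=W'\circ1_\lambda\otimes V$; $W'\otimes1_\lambda\circ1_\lambda\otimes W=W\circ W'=1_\lambda\otimes W'\circ W\otimes1_\lambda$. Two Frobenius algebras $(\lambda,V,V',W,W')$, $(\tilde\lambda,\tilde V,\tilde V',\tilde W,\tilde W')$ are isomorphic if there is an isomorphism $s:\lambda\to\tilde\lambda$ with $s\circ V=\tilde V$, $V'=\tilde V'\circ s$, $s\otimes s\circ W=\tilde W\circ s$, $s\circ W'=\tilde W'\circ s\otimes s$. An almost-2-category is defined like a 2-category except that unit 1-arrows are not required to exist for every object. $HOM_{\mathcal{E}}(A,A)$ is the tensor category of 1-arrows from $A$ to $A$ and 2-arrows between them. It is known (M. Müger) that each Frobenius algebra $\lambda$ in a strict tensor category $\mathcal{A}$ determines an almost-2-category $\mathcal{E}_0$ with $\mathrm{Obj}\,\mathcal{E}_0=\{A,B\}$, an isomorphism of tensor categories $I:\mathcal{A}\to HOM_{\mathcal{E}_0}(A,A)$, and 1-arrows $\rho:B\leftarrow A$, $\bar\rho:A\leftarrow B$ with $\bar\rho\otimes\rho=I(\lambda)$; $\mathcal{E}_0$ is $\mathbb{K}$-linear if $\mathcal{A}$ is, and isomorphic Frobenius algebras give isomorphic almost-2-categories. The proposition asserts that for this $\mathcal{E}_0$ (so in particular that there is such an assignment $\lambda\mapsto\mathcal{E}_0$ for which) the stated properties hold. The completion $\mathcal{E}_0^P$ has the same objects, 1-arrows the pairs $(X,P)$ with $X$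 a 1-arrow of $\mathcal{E}_0$ and $P=P\circ P\in\mathrm{End}(X)$, and $\mathrm{Hom}((X,P),(Y,Q))=Q\circ\mathrm{Hom}(X,Y)\circ P$. Conjugation (duality) relations for $\rho,\bar\rho$: $1_\rho\otimes d_\rho\circ e_\rho\otimes1_\rho=1_\rho$, $d_\rho\otimes1_{\bar\rho}\circ1_{\bar\rho}\otimes e_\rho=1_{\bar\rho}$, $\eta_\rho\otimes1_\rho\circ1_\rho\otimes\varepsilon_\rho=1_\rho$, $1_{\bar\rho}\otimes\eta_\rho\circ\varepsilon_\rho\otimes1_{\bar\rho}=1_{\bar\rho}$ (up to the coherence isomorphisms of the bicategory). *)

(* Defs.v *)
From HB Require Import structures.
From mathcomp Require Import all_boot all_order all_algebra.
From mathcomp Require Import complex.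
From mathcomp Require Import all_classical reals normedtype.
Import GRing.Theory Num.Theory numFieldNormedType.Exports.

Set Implicit Arguments.
Unset Strict Implicit.
Unset Printing Implicit Defensive.

Declare Scope tensor_scope.
Delimit Scope tensor_scope with T.
Declare Scope bicat_scope.
Delimit Scope bicat_scope with B.

Reserved Notation "g ∘ f" (at level 40, left associativity).
Reserved Notation "X ⊗ Y" (at level 35, right associativity).
Reserved Notation "f ⊠ g" (at level 35, right associativity).
Reserved Notation "f ^†" (at level 1, format "f ^†").

Record cat := Cat {
  obj :> Type;
  mor : obj -> obj -> Type;
  idm : forall X, mor X X;
  comp : forall X Y Z, mor Y Z -> mor X Y -> mor X Z;
  comp1m : forall X Y (f : mor X Y), comp (idm Y) f = f;
  compm1 : forall X Y (f : mor X Y), comp f (idm X) = f;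
  compA : forall X Y Z W (h : mor Z W) (g : mor Y Z) (f : mor X Y),
    comp h (comp g f) = comp (comp h g) f }.

Arguments mor {_}.
Arguments idm {_}.
Arguments comp {_} {_ _ _}.

Notation "g ∘ f" := (comp g f).

Record iso (C : cat) (X Y : C) := Iso {
  fwd :> mor X Y;
  bwd : mor Y X;
  bwdK : bwd ∘ fwd = idm X;
  fwdK : fwd ∘ bwd = idm Y }.

(** The identity morphism of [X], seen as a morphism [X -> Y] along an equality
    of objects. *)
Definition idhom (C : cat) (X Y : C) (e : X = Y) : mor X Y :=
  match e in _ = Z return mor X Z with erefl => idm X end.

Definition retract (C : cat) (Y X : C) : Prop :=
  exists (i : mor Y X) (r : mor X Y), r ∘ i = idm Y.

Record functor (C D : cat) := Functor {
  fob :> C -> D;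
  fmap : forall X Y, mor X Y -> mor (fob X) (fob Y);
  fmap_id : forall X, fmap (idm X) = idm (fob X);
  fmap_comp : forall X Y Z (g : mor Y Z) (f : mor X Y),
    fmap (g ∘ f) = fmap g ∘ fmap f }.

Arguments fmap {C D} _ {X Y}.

Definition fully_faithful (C D : cat) (F : functor C D) : Prop :=
  forall X Y, bijective (@fmap _ _ F X Y).

Definition functor_iso (C D : cat) (F : functor C D) : Prop :=
  bijective (fob F) /\ fully_faithful F.

(** [f ⊠ g] is the tensor product of morphisms, [X ⊗ Y] that of objects. *)
Record tensorcat := TensorCat {
  tcat :> cat;
  tens : tcat -> tcat -> tcat;
  tensm : forall X X' Y Y' : tcat,
    mor X X' -> mor Y Y' -> mor (tens X Y) (tens X' Y');
  tunit : tcat;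
  tassoc : forall X Y Z, iso (tens (tens X Y) Z) (tens X (tens Y Z));
  tlunit : forall X, iso (tens tunit X) X;
  trunit : forall X, iso (tens X tunit) X;
  tensm_id : forall X Y, tensm (idm X) (idm Y) = idm (tens X Y);
  tensm_comp : forall X X' X'' Y Y' Y'' (f' : mor X' X'') (f : mor X X')
      (g' : mor Y' Y'') (g : mor Y Y'),
    tensm (f' ∘ f) (g' ∘ g) = tensm f' g' ∘ tensm f g;
  tassoc_nat : forall X X' Y Y' Z Z' (f : mor X X') (g : mor Y Y')
      (h : mor Z Z'),
    tassoc X' Y' Z' ∘ tensm (tensm f g) h
    = tensm f (tensm g h) ∘ tassoc X Y Z;
  tlunit_nat : forall X X' (f : mor X X'),
    tlunit X' ∘ tensm (idm tunit) f = f ∘ tlunit X;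
  trunit_nat : forall X X' (f : mor X X'),
    trunit X' ∘ tensm f (idm tunit) = f ∘ trunit X;
  tpentagon : forall X Y Z W,
    tensm (idm X) (tassoc Y Z W) ∘ tassoc X (tens Y Z) W
      ∘ tensm (tassoc X Y Z) (idm W)
    = tassoc X Y (tens Z W) ∘ tassoc (tens X Y) Z W;
  ttriangle : forall X Y,
    tensm (idm X) (tlunit Y) ∘ tassoc X tunit Y
    = tensm (trunit X) (idm Y) }.

Arguments tens {_}.
Arguments tensm {_} {_ _ _ _}.
Arguments tunit {_}.
Arguments tassoc {_}.
Arguments tlunit {_}.
Arguments trunit {_}.

Notation "X ⊗ Y" := (tens X Y) : tensor_scope.
Notation "f ⊠ g" := (tensm f g) : tensor_scope.

(** Strictness: all constraints are identities (in particular tensor products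
    of objects are associative and unital on the nose). *)
Definition tensor_strict (M : tensorcat) : Prop :=
  [/\ forall X Y Z : M, exists e, tassoc X Y Z = idhom e :> mor _ _,
      forall X : M, exists e, tlunit X = idhom e :> mor _ _ &
      forall X : M, exists e, trunit X = idhom e :> mor _ _].

Section TensorFunctor.
Local Open Scope tensor_scope.

Record tensor_functor (M N : tensorcat) := TensorFunctor {
  tfun :> functor M N;
  tf2 : forall X Y : M, iso (tfun X ⊗ tfun Y) (tfun (X ⊗ Y));
  tf0 : iso tunit (tfun tunit);
  tf2_nat : forall (X X' Y Y' : M) (f : mor X X') (g : mor Y Y'),
    tf2 X' Y' ∘ (fmap tfun f ⊠ fmap tfun g) = fmap tfun (f ⊠ g) ∘ tf2 X Y;
  tf2_assoc : forall X Y Z : M,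
    fmap tfun (tassoc X Y Z) ∘ tf2 (X ⊗ Y) Z ∘ (tf2 X Y ⊠ idm (tfun Z))
    = tf2 X (Y ⊗ Z) ∘ (idm (tfun X) ⊠ tf2 Y Z)
      ∘ tassoc (tfun X) (tfun Y) (tfun Z);
  tf0_l : forall X : M,
    fmap tfun (tlunit X) ∘ tf2 tunit X ∘ (tf0 ⊠ idm (tfun X))
    = tlunit (tfun X);
  tf0_r : forall X : M,
    fmap tfun (trunit X) ∘ tf2 X tunit ∘ (idm (tfun X) ⊠ tf0)
    = trunit (tfun X) }.

End TensorFunctor.

Section Frobenius.
Local Open Scope tensor_scope.

Record frobdata (M : tensorcat) := FrobData {
  fr_ob :> M;
  fr_V : mor tunit fr_ob;
  fr_V' : mor fr_ob tunit;
  fr_W : mor fr_ob (fr_ob ⊗ fr_ob);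
  fr_W' : mor (fr_ob ⊗ fr_ob) fr_ob }.

Definition is_frobenius (M : tensorcat) (F : frobdata M) : Prop :=
  let: FrobData l V V' W W' := F in
  let one := idm l in
  let a := tassoc l l l in
  [/\ a ∘ (W ⊠ one) ∘ W = (one ⊠ W) ∘ W,
      W' ∘ (W' ⊠ one) = W' ∘ (one ⊠ W') ∘ a,
      tlunit l ∘ (V' ⊠ one) ∘ W = one /\ trunit l ∘ (one ⊠ V') ∘ W = one,
      W' ∘ (V ⊠ one) ∘ bwd (tlunit l) = one
        /\ W' ∘ (one ⊠ V) ∘ bwd (trunit l) = one &
      (W' ⊠ one) ∘ bwd a ∘ (one ⊠ W) = W ∘ W'
        /\ W ∘ W' = (one ⊠ W') ∘ a ∘ (W ⊠ one)].

Record frobenius (M : tensorcat) := Frobenius {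
  frobd :> frobdata M;
  frobP : is_frobenius frobd }.

Definition frob_isomorphic (M : tensorcat) (F G : frobdata M) : Prop :=
  exists s : iso F G,
    [/\ s ∘ fr_V F = fr_V G,
        fr_V' F = fr_V' G ∘ s,
        (s ⊠ s) ∘ fr_W F = fr_W G ∘ s &
        s ∘ fr_W' F = fr_W' G ∘ (s ⊠ s)].

Definition frob_image (M N : tensorcat) (I : tensor_functor M N)
    (F : frobdata M) : frobdata N :=
  let: FrobData l V V' W W' := F in
  @FrobData N (I l) (fmap I V ∘ tf0 I) (bwd (tf0 I) ∘ fmap I V')
    (bwd (tf2 I l l) ∘ fmap I W) (fmap I W' ∘ tf2 I l l).

End Frobenius.

(** A bicategory without units.  [bhom E b a] is the category of 1-arrows
    [b <- a]; following the tensor notation, the composite of [X : b <- a]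
    after [Y : a <- c] is written [X ⊗ Y]. *)
Record semibicat := SemiBicat {
  bob :> Type;
  bhom : bob -> bob -> cat;
  btens : forall c b a, bhom c b -> bhom b a -> bhom c a;
  btensm : forall c b a (X X' : bhom c b) (Y Y' : bhom b a),
    mor X X' -> mor Y Y' -> mor (btens X Y) (btens X' Y');
  bassoc : forall d c b a (X : bhom d c) (Y : bhom c b) (Z : bhom b a),
    iso (btens (btens X Y) Z) (btens X (btens Y Z));
  btensm_id : forall c b a (X : bhom c b) (Y : bhom b a),
    btensm (idm X) (idm Y) = idm (btens X Y);
  btensm_comp : forall c b a (X X' X'' : bhom c b) (Y Y' Y'' : bhom b a)
      (f' : mor X' X'') (f : mor X X') (g' : mor Y' Y'') (g : mor Y Y'),
    btensm (f' ∘ f) (g' ∘ g) = btensm f' g' ∘ btensm f g;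
  bassoc_nat : forall d c b a (X X' : bhom d c) (Y Y' : bhom c b)
      (Z Z' : bhom b a) (f : mor X X') (g : mor Y Y') (h : mor Z Z'),
    bassoc X' Y' Z' ∘ btensm (btensm f g) h
    = btensm f (btensm g h) ∘ bassoc X Y Z;
  bpentagon : forall e d c b a (X : bhom e d) (Y : bhom d c) (Z : bhom c b)
      (W : bhom b a),
    btensm (idm X) (bassoc Y Z W) ∘ bassoc X (btens Y Z) W
      ∘ btensm (bassoc X Y Z) (idm W)
    = bassoc X Y (btens Z W) ∘ bassoc (btens X Y) Z W }.

Arguments bhom {_}.
Arguments btens {_} {_ _ _}.
Arguments btensm {_} {_ _ _} {_ _ _ _}.
Arguments bassoc {_} {_ _ _ _}.

Notation "X ⊗ Y" := (btens X Y) : bicat_scope.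
Notation "f ⊠ g" := (btensm f g) : bicat_scope.

Section Bicategories.
Local Open Scope bicat_scope.

(** A unit 1-arrow for the object [b].  The triangle identity of a bicategory
    involves only the unit of the middle object, so that a bicategory is the
    same as a semibicategory with a unit for each object. *)
Record unit_at (E : semibicat) (b : E) := UnitAt {
  uarr :> bhom b b;
  ulunit : forall a (X : bhom b a), iso (uarr ⊗ X) X;
  urunit : forall c (X : bhom c b), iso (X ⊗ uarr) X;
  ulunit_nat : forall a (X X' : bhom b a) (f : mor X X'),
    ulunit X' ∘ (idm uarr ⊠ f) = f ∘ ulunit X;
  urunit_nat : forall c (X X' : bhom c b) (f : mor X X'),
    urunit X' ∘ (f ⊠ idm uarr) = f ∘ urunit X;
  utriangle : forall c a (X : bhom c b) (Y : bhom b a),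
    (idm X ⊠ ulunit Y) ∘ bassoc X uarr Y = urunit X ⊠ idm Y }.

Definition strict_unit (E : semibicat) (b : E) (u : unit_at b) : Prop :=
  (forall a (X : bhom b a), exists e, ulunit u X = idhom e :> mor _ _)
  /\ (forall c (X : bhom c b), exists e, urunit u X = idhom e :> mor _ _).

(** Like a 2-category (i.e. strict), without the requirement of units. *)
Record almost2cat := Almost2Cat {
  a2semi :> semibicat;
  a2strict : forall (d c b a : a2semi) (X : bhom d c) (Y : bhom c b)
      (Z : bhom b a),
    exists e, bassoc X Y Z = idhom e :> mor _ _ }.

Record bicat := Bicat {
  bsemi :> semibicat;
  bunit : forall a : bsemi, unit_at a }.

Definition HOMu (E : semibicat) (a : E) (u : unit_at a) : tensorcat :=
  @TensorCat (bhom a a) (@btens E a a a) (@btensm E a a a) u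
    (@bassoc E a a a a) (ulunit u (a:=a)) (urunit u (c:=a))
    (@btensm_id E a a a) (@btensm_comp E a a a) (@bassoc_nat E a a a a)
    (@ulunit_nat E a u a) (@urunit_nat E a u a) (@bpentagon E a a a a a)
    (@utriangle E a u a a).

Definition HOM (E : bicat) (a : E) : tensorcat := HOMu (bunit a).

(** Homomorphisms (pseudofunctors), first without units. *)
Record semipseudo (E F : semibicat) := SemiPseudo {
  psob :> E -> F;
  psfun : forall b a : E, functor (bhom b a) (bhom (psob b) (psob a));
  ps2 : forall (c b a : E) (X : bhom c b) (Y : bhom b a),
    iso (psfun c b X ⊗ psfun b a Y) (psfun c a (X ⊗ Y));
  ps2_nat : forall (c b a : E) (X X' : bhom c b) (Y Y' : bhom b a)
      (f : mor X X') (g : mor Y Y'),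
    ps2 X' Y' ∘ (fmap (psfun c b) f ⊠ fmap (psfun b a) g)
    = fmap (psfun c a) (f ⊠ g) ∘ ps2 X Y;
  ps2_assoc : forall (d c b a : E) (X : bhom d c) (Y : bhom c b)
      (Z : bhom b a),
    fmap (psfun d a) (bassoc X Y Z) ∘ ps2 (X ⊗ Y) Z
      ∘ (ps2 X Y ⊠ idm (psfun b a Z))
    = ps2 X (Y ⊗ Z) ∘ (idm (psfun d c X) ⊠ ps2 Y Z)
      ∘ bassoc (psfun d c X) (psfun c b Y) (psfun b a Z) }.

Record pseudo (E F : bicat) := Pseudo {
  pssemi :> semipseudo E F;
  ps0 : forall a : E, iso (uarr (bunit (pssemi a)))
                          (psfun pssemi a a (uarr (bunit a)));
  ps0_l : forall (b a : E) (X : bhom b a),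
    fmap (psfun pssemi b a) (ulunit (bunit b) X)
      ∘ ps2 pssemi (uarr (bunit b)) X ∘ (ps0 b ⊠ idm (psfun pssemi b a X))
    = ulunit (bunit (pssemi b)) (psfun pssemi b a X);
  ps0_r : forall (b a : E) (X : bhom b a),
    fmap (psfun pssemi b a) (urunit (bunit a) X)
      ∘ ps2 pssemi X (uarr (bunit a)) ∘ (idm (psfun pssemi b a X) ⊠ ps0 a)
    = urunit (bunit (pssemi a)) (psfun pssemi b a X) }.

(** Isomorphisms are the homomorphisms that are bijective on objects, 1-arrows
    and 2-arrows; composition of 1-arrows need only be preserved up to the
    coherent isomorphisms [ps2]. *)
Definition semipseudo_iso (E F : semibicat) (P : semipseudo E F) : Prop :=
  bijective (psob P) /\ forall b a, functor_iso (psfun P b a).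

Definition a2_isomorphic (E F : almost2cat) : Prop :=
  exists P : semipseudo E F, semipseudo_iso P.

Definition bicat_isomorphic (E F : bicat) : Prop :=
  exists P : pseudo E F, semipseudo_iso P.

Record karob (C : cat) := KarOb {
  kob :> C;
  kproj : mor kob kob;
  kprojP : kproj = kproj ∘ kproj }.

(** [Hom((X,P),(Y,Q)) = Q ∘ Hom(X,Y) ∘ P] *)
Definition karhom (C : cat) (X Y : karob C) : Type :=
  {f : mor (kob X) (kob Y) | exists g, f = kproj Y ∘ g ∘ kproj X}.

Section Karoubi.
Variable C : cat.

Lemma karhom_eq (X Y : karob C) (f g : karhom X Y) :
  sval f = sval g -> f = g.
Proof.
by case: f g => [f fP] [g gP] /= e; subst g; congr exist; exact: Prop_irrelevance.
Qed.

Lemma karhomPl (X Y : karob C) (f : karhom X Y) : kproj Y ∘ sval f = sval f.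
Proof. by case: f => f [g e] /=; rewrite e !compA -kprojP. Qed.

Lemma karhomPr (X Y : karob C) (f : karhom X Y) : sval f ∘ kproj X = sval f.
Proof. by case: f => f [g e] /=; rewrite e -!compA -kprojP. Qed.

Lemma karhom_fixP (X Y : karob C) (f : mor (kob X) (kob Y)) :
  kproj Y ∘ f = f -> f ∘ kproj X = f -> exists g, f = kproj Y ∘ g ∘ kproj X.
Proof. by move=> fl fr; exists f; rewrite fl fr. Qed.

Definition karhom_fix (X Y : karob C) (f : mor (kob X) (kob Y))
    (fl : kproj Y ∘ f = f) (fr : f ∘ kproj X = f) : karhom X Y :=
  exist _ f (karhom_fixP fl fr).

Definition karid (X : karob C) : karhom X X :=
  karhom_fix (esym (kprojP X)) (esym (kprojP X)).

Lemma karcomp_l (X Y Z : karob C) (g : karhom Y Z) (f : karhom X Y) :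
  kproj Z ∘ (sval g ∘ sval f) = sval g ∘ sval f.
Proof. by rewrite compA karhomPl. Qed.

Lemma karcomp_r (X Y Z : karob C) (g : karhom Y Z) (f : karhom X Y) :
  sval g ∘ sval f ∘ kproj X = sval g ∘ sval f.
Proof. by rewrite -compA karhomPr. Qed.

Definition karcomp (X Y Z : karob C) (g : karhom Y Z) (f : karhom X Y) :
    karhom X Z :=
  karhom_fix (karcomp_l g f) (karcomp_r g f).

Definition karoubi : cat.
Proof.
refine (@Cat (karob C) (@karhom C) karid karcomp _ _ _).
- by move=> X Y f; apply: karhom_eq; exact: karhomPl.
- by move=> X Y f; apply: karhom_eq; exact: karhomPr.
- by move=> X Y Z W h g f; apply: karhom_eq; exact: compA.
Defined.

End Karoubi.

Section Completion.
Variable E : semibicat.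

Lemma btens_projP c b a (X : karob (bhom (s:=E) c b)) (Y : karob (bhom b a)) :
  kproj X ⊠ kproj Y = (kproj X ⊠ kproj Y) ∘ (kproj X ⊠ kproj Y).
Proof. by rewrite -btensm_comp -!kprojP. Qed.

Definition ktens c b a (X : karoubi (bhom (s:=E) c b)) (Y : karoubi (bhom b a)) :
    karoubi (bhom c a) :=
  KarOb (btens_projP X Y).

Lemma ktensm_l c b a (X X' : karoubi (bhom (s:=E) c b))
    (Y Y' : karoubi (bhom b a)) (f : mor X X') (g : mor Y Y') :
  kproj (ktens X' Y') ∘ (sval f ⊠ sval g) = sval f ⊠ sval g.
Proof. by rewrite -btensm_comp !karhomPl. Qed.

Lemma ktensm_r c b a (X X' : karoubi (bhom (s:=E) c b))
    (Y Y' : karoubi (bhom b a)) (f : mor X X') (g : mor Y Y') :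
  (sval f ⊠ sval g) ∘ kproj (ktens X Y) = sval f ⊠ sval g.
Proof. by rewrite -btensm_comp !karhomPr. Qed.

Definition ktensm c b a (X X' : karoubi (bhom (s:=E) c b))
    (Y Y' : karoubi (bhom b a)) (f : mor X X') (g : mor Y Y') :
    mor (ktens X Y) (ktens X' Y') :=
  @karhom_fix _ (ktens X Y) (ktens X' Y') (sval f ⊠ sval g)
    (ktensm_l f g) (ktensm_r f g).

Section Assoc.
Variables (d c b a : E) (X : karoubi (bhom d c)) (Y : karoubi (bhom c b))
  (Z : karoubi (bhom b a)).
Let P1 := kproj (ktens (ktens X Y) Z).
Let P2 := kproj (ktens X (ktens Y Z)).
Let al := bassoc (kob X) (kob Y) (kob Z).

Let P1P : P1 ∘ P1 = P1.
Proof. exact: esym (kprojP _). Qed.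

Let P2P : P2 ∘ P2 = P2.
Proof. exact: esym (kprojP _). Qed.

Let alP : al ∘ P1 = P2 ∘ al.
Proof. exact: bassoc_nat. Qed.

Let alVP : P1 ∘ bwd al = bwd al ∘ P2.
Proof.
by rewrite -[LHS]comp1m -(bwdK al) compA -(compA (bwd al)) alP -!compA fwdK
  compm1.
Qed.

Lemma kassoc_l : P2 ∘ (P2 ∘ al) = P2 ∘ al.
Proof. by rewrite compA P2P. Qed.

Lemma kassoc_r : P2 ∘ al ∘ P1 = P2 ∘ al.
Proof. by rewrite -compA alP compA P2P. Qed.

Lemma kassocV_l : P1 ∘ (P1 ∘ bwd al) = P1 ∘ bwd al.
Proof. by rewrite compA P1P. Qed.

Lemma kassocV_r : P1 ∘ bwd al ∘ P2 = P1 ∘ bwd al.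
Proof. by rewrite -compA -alVP compA P1P. Qed.

(** The associativity constraint restricted to the projections; for strict [E]
    it is the identity 2-arrow [P ⊠ Q ⊠ R] of [(X ⊗ Y ⊗ Z, P ⊠ Q ⊠ R)]. *)
Definition kassoc : iso (ktens (ktens X Y) Z) (ktens X (ktens Y Z)).
Proof.
refine (@Iso (karoubi _) (ktens (ktens X Y) Z) (ktens X (ktens Y Z))
  (@karhom_fix _ (ktens (ktens X Y) Z) (ktens X (ktens Y Z)) (P2 ∘ al)
     kassoc_l kassoc_r)
  (@karhom_fix _ (ktens X (ktens Y Z)) (ktens (ktens X Y) Z) (P1 ∘ bwd al)
     kassocV_l kassocV_r) _ _).
- apply: karhom_eq; rewrite /= -/P1 -/P2 -/al alVP -compA (compA P2) P2P.
  by rewrite -alP compA bwdK comp1m.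
- apply: karhom_eq; rewrite /= -/P1 -/P2 -/al -alP -compA (compA P1) P1P.
  by rewrite alVP compA fwdK comp1m.
Defined.

End Assoc.

Definition completion : semibicat.
Proof.
refine (@SemiBicat E (fun b a => karoubi (bhom b a)) ktens ktensm kassoc
  _ _ _ _).
- by move=> c b a X Y; apply: karhom_eq.
- by move=> c b a X X' X'' Y Y' Y'' f' f g' g; apply: karhom_eq;
    rewrite /= btensm_comp.
- move=> d c b a X X' Y Y' Z Z' f g h; apply: karhom_eq => /=.
  rewrite -compA bassoc_nat compA -!btensm_comp !karhomPl compA.
  by rewrite -!btensm_comp !karhomPr.
- move=> e d c b a X Y Z W; apply: karhom_eq => /=.
  set p := kproj X; set q := kproj Y; set r := kproj Z; set s := kproj W.
  have pp : p ∘ p = p by exact: esym (kprojP _).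
  have qq : q ∘ q = q by exact: esym (kprojP _).
  have rr : r ∘ r = r by exact: esym (kprojP _).
  have ss : s ∘ s = s by exact: esym (kprojP _).
  set a1 := bassoc (kob Y) _ _; set a2 := bassoc (kob X) (kob Y ⊗ kob Z) _.
  set a3 := bassoc (kob X) (kob Y) (kob Z).
  set a4 := bassoc (kob X) (kob Y) (_ ⊗ _); set a5 := bassoc (_ ⊗ _) _ _.
  have -> : p ⊠ ((q ⊠ r ⊠ s) ∘ a1) = (p ⊠ q ⊠ r ⊠ s) ∘ (idm _ ⊠ a1).
    by rewrite -btensm_comp compm1.
  have -> : ((p ⊠ q ⊠ r) ∘ a3) ⊠ s = ((p ⊠ q ⊠ r) ⊠ s) ∘ (a3 ⊠ idm _).
    by rewrite -btensm_comp compm1.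
  have n1 : (idm (kob X) ⊠ a1) ∘ (p ⊠ (q ⊠ r) ⊠ s)
          = (p ⊠ q ⊠ r ⊠ s) ∘ (idm (kob X) ⊠ a1).
    by rewrite -!btensm_comp comp1m compm1 bassoc_nat.
  have n2 : a2 ∘ ((p ⊠ q ⊠ r) ⊠ s) = (p ⊠ (q ⊠ r) ⊠ s) ∘ a2.
    exact: bassoc_nat.
  have n4 : a4 ∘ ((p ⊠ q) ⊠ r ⊠ s) = (p ⊠ q ⊠ r ⊠ s) ∘ a4.
    exact: bassoc_nat.
  set Q := p ⊠ q ⊠ r ⊠ s in n1 n4 *.
  set P := p ⊠ (q ⊠ r) ⊠ s in n1 n2 *; set S := (p ⊠ q ⊠ r) ⊠ s in n2 *.
  have QQ : Q ∘ Q = Q by rewrite /Q -!btensm_comp pp qq rr ss.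
  have PP : P ∘ P = P by rewrite /P -!btensm_comp pp qq rr ss.
  set u := idm (kob X) ⊠ a1 in n1 *; set v := a3 ⊠ idm (kob W).
  have -> : Q ∘ u ∘ (P ∘ a2) ∘ (S ∘ v) = Q ∘ (u ∘ a2 ∘ v).
    rewrite (compA _ S v) -(compA _ (P ∘ a2) S) -(compA P a2 S) n2 (compA P P a2).
    by rewrite PP (compA _ P a2) -(compA Q u P) n1 (compA Q Q u) QQ !compA.
  rewrite /u /v bpentagon -/a4 -/a5.
  by rewrite (compA (Q ∘ a4)) -(compA Q a4) n4 (compA Q Q) QQ -compA.
Defined.

End Completion.

Record preadditive (E : bicat) := Preadditive {
  pa_class : forall (b a : E) (X Y : bhom b a), GRing.Zmodule (mor X Y);
  pa_hom := fun (b a : E) (X Y : bhom b a) =>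
    GRing.Zmodule.Pack (pa_class X Y) : zmodType;
  pa_add := fun (b a : E) (X Y : bhom b a) (f g : mor X Y) =>
    ((f : pa_hom X Y) + g)%R : mor X Y;
  pa_compl : forall (b a : E) (X Y Z : bhom b a) (h h' : mor Y Z)
      (f : mor X Y),
    pa_add h h' ∘ f = pa_add (h ∘ f) (h' ∘ f);
  pa_compr : forall (b a : E) (X Y Z : bhom b a) (h : mor Y Z)
      (f f' : mor X Y),
    h ∘ pa_add f f' = pa_add (h ∘ f) (h ∘ f');
  pa_tensl : forall (c b a : E) (X X' : bhom c b) (Y Y' : bhom b a)
      (f f' : mor X X') (g : mor Y Y'),
    pa_add f f' ⊠ g = pa_add (f ⊠ g) (f' ⊠ g);
  pa_tensr : forall (c b a : E) (X X' : bhom c b) (Y Y' : bhom b a)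
      (f : mor X X') (g g' : mor Y Y'),
    f ⊠ pa_add g g' = pa_add (f ⊠ g) (f ⊠ g') }.

Definition has_direct_sums2 (E : bicat) (pa : preadditive E) : Prop :=
  forall (b a : E) (X Y : bhom b a), exists (Z : bhom b a)
      (u : mor X Z) (u' : mor Z X) (v : mor Y Z) (v' : mor Z Y),
    [/\ u' ∘ u = idm X, v' ∘ v = idm Y &
        pa_add pa (u ∘ u') (v ∘ v') = idm Z].

Record linear2 (K : nzRingType) (E : semibicat) := Linear2 {
  l2_class : forall (b a : E) (X Y : bhom b a), GRing.Lmodule K (mor X Y);
  l2_hom := fun (b a : E) (X Y : bhom b a) =>
    GRing.Lmodule.Pack (l2_class X Y) : lmodType K;
  l2_lin := fun (b a : E) (X Y : bhom b a) (k : K) (f g : mor X Y) =>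
    (k *: (f : l2_hom X Y) + (g : l2_hom X Y))%R : mor X Y;
  l2_compl : forall (b a : E) (X Y Z : bhom b a) k (h h' : mor Y Z)
      (f : mor X Y),
    l2_lin k h h' ∘ f = l2_lin k (h ∘ f) (h' ∘ f);
  l2_compr : forall (b a : E) (X Y Z : bhom b a) k (h : mor Y Z)
      (f f' : mor X Y),
    h ∘ l2_lin k f f' = l2_lin k (h ∘ f) (h ∘ f');
  l2_tensl : forall (c b a : E) (X X' : bhom c b) (Y Y' : bhom b a) k
      (f f' : mor X X') (g : mor Y Y'),
    l2_lin k f f' ⊠ g = l2_lin k (f ⊠ g) (f' ⊠ g);
  l2_tensr : forall (c b a : E) (X X' : bhom c b) (Y Y' : bhom b a) k
      (f : mor X X') (g g' : mor Y Y'),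
    f ⊠ l2_lin k g g' = l2_lin k (f ⊠ g) (f ⊠ g') }.

Definition conjugation_relations (E : bicat) (A B : E)
    (rho : bhom B A) (rhob : bhom A B)
    (e : mor (uarr (bunit B)) (rho ⊗ rhob))
    (eps : mor (uarr (bunit A)) (rhob ⊗ rho))
    (d : mor (rhob ⊗ rho) (uarr (bunit A)))
    (eta : mor (rho ⊗ rhob) (uarr (bunit B))) : Prop :=
  let lA := ulunit (bunit A) in let rA := urunit (bunit A) in
  let lB := ulunit (bunit B) in let rB := urunit (bunit B) in
  [/\ rA _ rho ∘ (idm rho ⊠ d) ∘ bassoc rho rhob rho ∘ (e ⊠ idm rho)
        ∘ bwd (lB _ rho) = idm rho,
      lA _ rhob ∘ (d ⊠ idm rhob) ∘ bwd (bassoc rhob rho rhob)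
        ∘ (idm rhob ⊠ e) ∘ bwd (rB _ rhob) = idm rhob,
      lB _ rho ∘ (eta ⊠ idm rho) ∘ bwd (bassoc rho rhob rho)
        ∘ (idm rho ⊠ eps) ∘ bwd (rA _ rho) = idm rho &
      rB _ rhob ∘ (idm rhob ⊠ eta) ∘ bassoc rhob rho rhob
        ∘ (eps ⊠ idm rhob) ∘ bwd (lA _ rhob) = idm rhob].

(** [(rhob ⊗ rho, eps, d, 1 ⊠ e ⊠ 1, 1 ⊠ eta ⊠ 1)], the last two 2-arrows being
    completed by the constraints
    [rhob ⊗ rho ≅ rhob ⊗ (1_B ⊗ rho)] and
    [rhob ⊗ ((rho ⊗ rhob) ⊗ rho) ≅ (rhob ⊗ rho) ⊗ (rhob ⊗ rho)]. *)
Definition conjugation_frobdata (E : bicat) (A B : E)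
    (rho : bhom B A) (rhob : bhom A B)
    (e : mor (uarr (bunit B)) (rho ⊗ rhob))
    (eps : mor (uarr (bunit A)) (rhob ⊗ rho))
    (d : mor (rhob ⊗ rho) (uarr (bunit A)))
    (eta : mor (rho ⊗ rhob) (uarr (bunit B))) : frobdata (HOM A) :=
  let lB := ulunit (bunit B) rho in
  let a1 := bassoc rho rhob rho in
  let a2 := bassoc rhob rho (rhob ⊗ rho) in
  @FrobData (HOM A) (rhob ⊗ rho) eps d
    (bwd a2 ∘ (idm rhob ⊠ a1) ∘ (idm rhob ⊠ e ⊠ idm rho)
       ∘ (idm rhob ⊠ bwd lB))
    ((idm rhob ⊠ lB) ∘ (idm rhob ⊠ eta ⊠ idm rho)
       ∘ (idm rhob ⊠ bwd a1) ∘ a2).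

End Bicategories.

Section TensorCStar.
Local Open Scope tensor_scope.
Local Open Scope ring_scope.

Record banach_tensorcat (R : realType) := BanachTensorCat {
  bt_cat :> tensorcat;
  bt_class : forall X Y : bt_cat, CompleteNormedModule R[i] (mor X Y) }.

Definition bthom (R : realType) (A : banach_tensorcat R) (X Y : A) :
    completeNormedModType R[i] :=
  CompleteNormedModule.Pack (bt_class X Y).

(** Positivity in the C*-algebra [End(X)]: self-adjoint with spectrum in
    [[0, +oo[]; on [R[i]], [0 <= mu] means that [mu] is real and nonnegative. *)
Definition cstar_positive (R : realType) (A : banach_tensorcat R)
    (star : forall X Y : A, mor X Y -> mor Y X) (X : A) (f : mor X X) : Prop :=
  star X X f = f /\
  forall mu : R[i],
    ~ (exists g : mor X X,
         let h : mor X X := (f : bthom X X) - mu *: (idm X : bthom X X) in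
         g ∘ h = idm X /\ h ∘ g = idm X) ->
    0 <= mu.

Record tensor_cstar (R : realType) := TensorCStar {
  tcs_bt :> banach_tensorcat R;
  tcs_strict : tensor_strict tcs_bt;
  star : forall X Y : tcs_bt, mor X Y -> mor Y X;
  tcs_compl : forall (X Y Z : tcs_bt) (k : R[i]) (h h' : bthom Y Z)
      (f : mor X Y),
    ((k *: h + h' : bthom Y Z) ∘ f)
    = k *: (h ∘ f : bthom X Z) + (h' ∘ f : bthom X Z);
  tcs_compr : forall (X Y Z : tcs_bt) (k : R[i]) (h : mor Y Z)
      (f f' : bthom X Y),
    (h ∘ (k *: f + f' : bthom X Y))
    = k *: (h ∘ f : bthom X Z) + (h ∘ f' : bthom X Z);
  tcs_tensl : forall (X X' Y Y' : tcs_bt) (k : R[i]) (f f' : bthom X X')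
      (g : mor Y Y'),
    ((k *: f + f' : bthom X X') ⊠ g)
    = k *: (f ⊠ g : bthom (X ⊗ Y) (X' ⊗ Y'))
      + (f' ⊠ g : bthom (X ⊗ Y) (X' ⊗ Y'));
  tcs_tensr : forall (X X' Y Y' : tcs_bt) (k : R[i]) (f : mor X X')
      (g g' : bthom Y Y'),
    (f ⊠ (k *: g + g' : bthom Y Y'))
    = k *: (f ⊠ g : bthom (X ⊗ Y) (X' ⊗ Y'))
      + (f ⊠ g' : bthom (X ⊗ Y) (X' ⊗ Y'));
  star_antilinear : forall (X Y : tcs_bt) (k : R[i]) (f g : bthom X Y),
    star (k *: f + g : bthom X Y)
    = k^* *: (star f : bthom Y X) + (star g : bthom Y X);
  star_invol : forall (X Y : tcs_bt) (f : mor X Y), star (star f) = f;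
  star_comp : forall (X Y Z : tcs_bt) (g : mor Y Z) (f : mor X Y),
    star (g ∘ f) = star f ∘ star g;
  star_tens : forall (X X' Y Y' : tcs_bt) (f : mor X X') (g : mor Y Y'),
    star (f ⊠ g) = star f ⊠ star g;
  norm_comp : forall (X Y Z : tcs_bt) (g : mor Y Z) (f : mor X Y),
    `|(g ∘ f : bthom X Z)| <= `|(g : bthom Y Z)| * `|(f : bthom X Y)|;
  norm_cstar : forall (X Y : tcs_bt) (f : mor X Y),
    `|(star f ∘ f : bthom X X)| = `|(f : bthom X Y)| ^+ 2;
  star_positive : forall (X Y : tcs_bt) (f : mor X Y),
    cstar_positive star (star f ∘ f) }.

End TensorCStar.

Arguments star {R t X Y}.
Notation "f ^†" := (star f) : tensor_scope.

Section Closure.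
Local Open Scope tensor_scope.
Variables (R : realType) (A : tensor_cstar R).

Definition isometry (X Y : A) (W : mor X Y) : Prop := W^† ∘ W = idm X.

Definition closed_under_projections : Prop :=
  forall (X : A) (P : mor X X), P = P ∘ P -> P = P^† ->
  exists (Y : A) (W : mor Y X), isometry W /\ P = W ∘ W^†.

Definition closed_under_direct_sums : Prop :=
  forall X Y : A, exists (Z : A) (U : mor X Z) (V : mor Y Z),
    [/\ isometry U, isometry V &
        ((U ∘ U^† : bthom Z Z) + (V ∘ V^† : bthom Z Z))%R = idm Z].

Definition closed_under_conjugation : Prop :=
  forall X : A, exists (Xb : A) (r : mor tunit (Xb ⊗ X))
      (rb : mor tunit (X ⊗ Xb)),
    tlunit X ∘ (rb^† ⊠ idm X) ∘ bwd (tassoc X Xb X) ∘ (idm X ⊠ r)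
      ∘ bwd (trunit X) = idm X
    /\ tlunit Xb ∘ (r^† ⊠ idm Xb) ∘ bwd (tassoc Xb X Xb) ∘ (idm Xb ⊠ rb)
      ∘ bwd (trunit Xb) = idm Xb.

Definition star_frobenius (F : frobdata A) : Prop :=
  fr_V' F = (fr_V F)^† /\ fr_W' F = (fr_W F)^†.

End Closure.

(** The almost-2-category [E_0] is described by its characteristic data: objects
    [A <> B], an isomorphism [I] of (linear) tensor categories from the given one
    to [HOM(A,A)], and 1-arrows [rho : B <- A], [rhob : A <- B] with
    [rhob ⊗ rho = I(lambda)]. *)
Record associated_a2cat (R : realType) (A : tensor_cstar R) (F : frobenius A) :=
  AssociatedA2Cat {
  as_a2 :> almost2cat;
  as_A : as_a2;
  as_B : as_a2;
  as_AB : as_A <> as_B;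
  as_obj : forall c : as_a2, c = as_A \/ c = as_B;
  (* the object [as_A] has a unit, so that [HOM(A,A)] is a tensor category *)
  as_unit : unit_at as_A;
  as_unit_strict : strict_unit as_unit;
  as_I : tensor_functor A (HOMu as_unit);
  as_I_iso : functor_iso as_I;
  as_rho : bhom as_B as_A;
  as_rhob : bhom as_A as_B;
  as_rhobrho : btens as_rhob as_rho = as_I F;
  as_lin : linear2 R[i] as_a2;
  as_I_lin : forall (X Y : A) (k : R[i]) (f g : bthom X Y),
    fmap as_I (k *: f + g : bthom X Y)%R
    = l2_lin as_lin k (fmap as_I f) (fmap as_I g) }.

Definition completion_bicat (R : realType) (A : tensor_cstar R)
    (F : frobenius A) (E0 : associated_a2cat F)
    (U : forall a : completion E0, unit_at a) : bicat :=
  @Bicat (completion E0) U.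

(* Main.v *)
(** The 2-arrows of [E_0] are realised inside the strict 2-category of
    endofunctors of [A] of the form [X ⊗ -] (a Cayley representation, in which
    composition of functors is associative on the nose).  With [M_A] the identity
    monad and [M_B = λ ⊗ -], a 1-arrow [b <- a] is a functor [X], a 2-arrow
    [X -> Y] is an [(M_b, M_a)]-bimodule transformation [M_b X M_a -> M_b Y M_a],
    and [X ⊗ Y = X M_b Y]; thus [rho] and [rhob] are identity functors and
    [rhob ⊗ rho = M_B].

    In the completion, the unit at [b] is the identity functor with the
    projection [σ μ], for a bimodule section [σ] of the multiplication [μ] of
    [M_b].  Such a section is [W (W' W)^-1]; that [W' W = W^* W] is invertible
    follows from [W] having the left inverse [V' ⊗ 1], by Kaplansky's argument
    on idempotents in C*-algebras.  Then [e_rho = W W'], [eta_rho = σ W'],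
    [eps_rho = V] and [d_rho = V'] satisfy the conjugation relations.

    An isomorphism of Frobenius algebras induces isomorphisms [t_b] of monads,
    and conjugation with [t_b X t_a] is an isomorphism of the bicategories. *)

Require Import Defs.
From HB Require Import structures.
From mathcomp Require Import all_boot all_order all_algebra.
From mathcomp Require Import complex.
From mathcomp Require Import all_classical reals normedtype.
Import GRing.Theory Num.Theory.
Import Defs.

Set Implicit Arguments.
Unset Strict Implicit.
Unset Printing Implicit Defensive.

Local Open Scope tensor_scope.

(** * Strictness by equality of packed morphisms *)

Section PackedMorphisms.
Variable C : cat.

(** A 1-arrow [X : b <- a] stands for the free bimodule [M_b X M_a]. Since [M_c X M_b] tensored over
    [M_b] with [M_b Y M_a] is [M_c X M_b Y M_a], horizontal composition needs no coequaliser and is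
    strict. The unit bimodule [M_b] need not be free; a bimodule section of the multiplication makes
    it a retract of the free bimodule [M_b M_b], which is why the unit at [B] is found in the
    completion. The obstacle is equality of objects. In a strict tensor category [(X ⊗ Y) ⊗ Z] and
    [X ⊗ (Y ⊗ Z)] are equal but not convertible, so that composites fill up with transports.
    Functors remove this for composition of 1-arrows. What remains is compared after packing a
    morphism with its source and target. To get an isomorphism of the given category with
    [HOM(A,A)], and not a larger category, transformations must be compatible with tensoring on the
    right; they are then determined by their component at the unit object. *)

Definition pack (X Y : C) (f : mor X Y) : {X : C & {Y : C & mor X Y}} :=
  existT _ X (existT _ Y f).

End PackedMorphisms.

(** By strictness, composing with associativity and unit constraints does not
    change a morphism up to [≈]. *)
Notation "f ≈ g" := (pack f = pack g) (at level 70, no associativity).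

Section PackedTheory.
Variable C : cat.
Implicit Types X Y Z : C.

(** The equality of pairs yields a proof of [x = x], which proof irrelevance identifies with
    [erefl]. *)
Lemma existT_inj (T : Type) (P : T -> Type) (x : T) (a b : P x) :
  existT P x a = existT P x b -> a = b.
Proof.
move=> e; have := projT2_eq e.
by rewrite (Prop_irrelevance (projT1_eq e) erefl).
Qed.

Lemma pack_inj X Y (f g : mor X Y) : f ≈ g -> f = g.
Proof. by move=> e; exact: existT_inj (existT_inj e). Qed.

(** Source and target vary together with the morphism, so that replacing [f] along [≈] never meets
    an ill-typed intermediate goal. *)
Lemma pack_elim X Y (f : mor X Y) (P : forall X' Y' : C, mor X' Y' -> Prop) :
  P X Y f -> forall X' Y' (f' : mor X' Y'), f ≈ f' -> P X' Y' f'.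
Proof.
move=> Pf X' Y' f' e.
by rewrite -[P X' Y' f']/(P _ _ (projT2 (projT2 (pack f')))) -e.
Qed.

Lemma pack_comp X Y Z (f : mor X Y) (g : mor Y Z) X' Y' Z' (f' : mor X' Y')
    (g' : mor Y' Z') : f ≈ f' -> g ≈ g' -> g ∘ f ≈ g' ∘ f'.
Proof.
move=> ef; move: X' Y' f' ef g'.
apply: (pack_elim (P := fun X' Y' f' => forall g' : mor Y' Z', g ≈ g' ->
  g ∘ f ≈ g' ∘ f')) => g' eg.
have eZ : Z = Z' by exact: (congr1 (fun p => projT1 (projT2 p)) eg).
by subst Z'; rewrite (pack_inj eg).
Qed.

Lemma pack_id X X' : X = X' -> idm X ≈ idm X'.
Proof. by move=> ->. Qed.

Lemma pack_idhom X Y (e : X = Y) : idhom e ≈ idm X.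
Proof. by case: _ / e. Qed.

Lemma idhom_pack X Y (f : mor X Y) : f ≈ idm X -> exists e, f = idhom e.
Proof.
move=> ef; have e : X = Y.
  exact: (congr1 (fun p => projT1 (projT2 p)) (esym ef)).
by exists e; subst Y; exact: pack_inj.
Qed.

Lemma idhom_comp X Y Z (e : Y = Z) (f : mor X Y) : idhom e ∘ f ≈ f.
Proof. by case: _ / e; rewrite comp1m. Qed.

Lemma comp_idhom X Y Z (e : X = Y) (f : mor Y Z) : f ∘ idhom e ≈ f.
Proof. by subst Y; rewrite compm1. Qed.

Lemma bwd_idhom X Y (i : iso X Y) (e : X = Y) : fwd i = idhom e ->
  bwd i = idhom (esym e).
Proof.
move=> ei; subst Y; have := bwdK i; rewrite ei /= => <-.
by rewrite compm1.
Qed.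

Definition cast X Y X' Y' (eX : X = X') (eY : Y = Y') (f : mor X Y) :
    mor X' Y' :=
  idhom eY ∘ f ∘ idhom (esym eX).

Lemma pack_cast X Y X' Y' (eX : X = X') (eY : Y = Y') (f : mor X Y) :
  cast eX eY f ≈ f.
Proof. by subst X' Y'; rewrite /cast comp1m compm1. Qed.

Definition is_iso X Y (f : mor X Y) : Prop :=
  exists g : mor Y X, g ∘ f = idm X /\ f ∘ g = idm Y.

End PackedTheory.

(** * Strict tensor categories: constraints are invisible up to [≈] *)

Record strictcat := StrictCat {
  sctens :> tensorcat;
  scstrict : tensor_strict sctens }.

Section StrictTensor.
Variable A : strictcat.
Implicit Types X Y Z : A.

Lemma pack_tens X Y (f : mor X Y) Z W (g : mor Z W) X' Y' (f' : mor X' Y')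
    Z' W' (g' : mor Z' W') : f ≈ f' -> g ≈ g' -> f ⊠ g ≈ f' ⊠ g'.
Proof.
move=> ef; move: X' Y' f' ef.
apply: (pack_elim (P := fun X' Y' f' => g ≈ g' -> f ⊠ g ≈ f' ⊠ g')).
move: Z' W' g'.
exact: (pack_elim (P := fun Z' W' g' => f ⊠ g ≈ f ⊠ g')).
Qed.

Lemma pack_tassoc X Y Z : tassoc X Y Z ≈ idm ((X ⊗ Y) ⊗ Z).
Proof. by case: (scstrict A) => /(_ X Y Z)[e ->] _ _; exact: pack_idhom. Qed.

Lemma pack_tassocV X Y Z : bwd (tassoc X Y Z) ≈ idm (X ⊗ (Y ⊗ Z)).
Proof.
by case: (scstrict A) => /(_ X Y Z)[e /bwd_idhom->] _ _; exact: pack_idhom.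
Qed.

Lemma pack_tlunit X : tlunit X ≈ idm (tunit ⊗ X).
Proof. by case: (scstrict A) => _ /(_ X)[e ->] _; exact: pack_idhom. Qed.

Lemma pack_tlunitV X : bwd (tlunit X) ≈ idm X.
Proof. by case: (scstrict A) => _ /(_ X)[e /bwd_idhom->] _; exact: pack_idhom. Qed.

Lemma pack_trunit X : trunit X ≈ idm (X ⊗ tunit).
Proof. by case: (scstrict A) => _ _ /(_ X)[e ->]; exact: pack_idhom. Qed.

Lemma pack_trunitV X : bwd (trunit X) ≈ idm X.
Proof. by case: (scstrict A) => _ _ /(_ X)[e /bwd_idhom->]; exact: pack_idhom. Qed.

Lemma tensA X Y Z : (X ⊗ Y) ⊗ Z = X ⊗ (Y ⊗ Z).
Proof. by case: (scstrict A) => /(_ X Y Z)[]. Qed.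

Lemma tens1X X : tunit ⊗ X = X.
Proof. by case: (scstrict A) => _ /(_ X)[]. Qed.

Lemma tensX1 X : X ⊗ tunit = X.
Proof. by case: (scstrict A) => _ _ /(_ X)[]. Qed.

Lemma tensmA X Y (f : mor X Y) Z W (g : mor Z W) X' Y' (h : mor X' Y') :
  (f ⊠ g) ⊠ h ≈ f ⊠ (g ⊠ h).
Proof.
have n := tassoc_nat f g h; case: (scstrict A) => s _ _; move: n.
case: (s X Z X') => e ->; case: (s Y W Y') => e' -> n.
by have /esym := idhom_comp e' ((f ⊠ g) ⊠ h); rewrite n comp_idhom => <-.
Qed.

Lemma tensm1f X Y (f : mor X Y) : idm tunit ⊠ f ≈ f.
Proof.
have n := tlunit_nat f; case: (scstrict A) => _ s _; move: n.
case: (s X) => e ->; case: (s Y) => e' -> n.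
by have /esym := idhom_comp e' (idm tunit ⊠ f); rewrite n comp_idhom => <-.
Qed.

End StrictTensor.

(** * The functors [X ⊗ -] *)

Section TensoringFunctors.
Variable A : strictcat.

(** Functor data only: the laws are those of [canon], so that composition of
    [efun] is associative up to conversion. *)
Record efun := EFun {
  eob :> A -> A;
  emo : forall Z W, mor Z W -> mor (eob Z) (eob W) }.

Definition canon (X : A) : efun :=
  EFun (fun Z W (f : mor Z W) => idm X ⊠ f).

(** The object [X] is only asserted to exist: an [lfun] is then determined by its functor data, and
    composites that agree by conversion differ at most in a proof. *)
Record lfun := LFun {
  lefun :> efun;
  lfunP : exists X, lefun = canon X }.

Definition lcanon (X : A) : lfun := LFun (ex_intro _ X erefl).

Definition eid : efun := @EFun id (fun Z W f => f).

Definition ecomp (S T : efun) : efun :=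
  @EFun (fun Z => S (T Z)) (fun Z W f => emo S (emo T f)).

(** These are the morphisms of right module categories over the tensor category. Among all families
    the condition singles out those of the form [f tunit ⊠ idm Z], up to [≈]. *)
Definition strong (S T : efun) (f : forall Z, mor (S Z) (T Z)) : Prop :=
  forall Z W, f Z ⊠ idm W ≈ f (Z ⊗ W).

Lemma efun_eq (S T : efun) : (forall Z, S Z = T Z) ->
  (forall Z W (f : mor Z W), emo S f ≈ emo T f) -> S = T.
Proof.
case: S T => [s s1] [t t1] /= e; have es : s = t by apply: funext.
subst t => e1; congr EFun; do 3!apply: functional_extensionality_dep => ?.
exact: pack_inj.
Qed.

Lemma lfun_eq (S T : lfun) : lefun S = lefun T -> S = T.
Proof.
by case: S T => [s sP] [t tP] /= e; subst t; congr LFun; apply: Prop_irrelevance.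
Qed.

Lemma pack_emo (S : efun) Z W (f : mor Z W) Z' W' (f' : mor Z' W') :
  f ≈ f' -> emo S f ≈ emo S f'.
Proof.
move: Z' W' f'.
exact: (pack_elim (P := fun Z' W' f' => emo S f ≈ emo S f')).
Qed.

Lemma pack_family (S T : efun) (f : forall Z, mor (S Z) (T Z)) Z W :
  Z = W -> f Z ≈ f W.
Proof. by move=> ->. Qed.

Lemma emo_id (S : lfun) Z : emo S (idm Z) = idm (S Z).
Proof. by case: S => s [X eX]; subst s; exact: tensm_id. Qed.

Lemma emo_comp (S : lfun) Z W V (g : mor W V) (f : mor Z W) :
  emo S (g ∘ f) = emo S g ∘ emo S f.
Proof. by case: S => s [X eX]; subst s; rewrite /= -tensm_comp compm1. Qed.

Lemma strong_id (S : efun) : strong (S := S) (fun Z => idm (S Z)) <->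
  forall Z W, S Z ⊗ W = S (Z ⊗ W).
Proof.
split=> [s Z W|s Z W]; last by rewrite tensm_id s.
by have := s Z W; rewrite tensm_id => /(congr1 (fun p => projT1 p)).
Qed.

Lemma strong_comp (S T U : efun) (g : forall Z, mor (T Z) (U Z))
    (f : forall Z, mor (S Z) (T Z)) :
  strong g -> strong f -> strong (fun Z => g Z ∘ f Z).
Proof.
move=> gs fs Z W; rewrite -{1}(compm1 (idm W)) tensm_comp.
exact: pack_comp (fs Z W) (gs Z W).
Qed.

Lemma eob_tens (S : lfun) Z W : S Z ⊗ W = S (Z ⊗ W).
Proof. by case: S => s [X eX]; subst s; exact: tensA. Qed.

Lemma emo_tens (S : lfun) Z W (f : mor Z W) V :
  emo S f ⊠ idm V ≈ emo S (f ⊠ idm V).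
Proof. by case: S => s [X eX]; subst s; exact: tensmA. Qed.

Lemma lidP : exists X, eid = canon X.
Proof.
exists tunit; apply: efun_eq => [Z|Z W f] /=; first by rewrite tens1X.
by rewrite tensm1f.
Qed.

Definition lid : lfun := LFun lidP.

Lemma lcompP (S T : lfun) : exists X, ecomp S T = canon X.
Proof.
case: S T => s [X eX] [t [Y eY]]; subst s t; exists (X ⊗ Y).
apply: efun_eq => [Z|Z W f] /=; first by rewrite tensA.
by rewrite -tensmA tensm_id.
Qed.

Definition lcomp (S T : lfun) : lfun := LFun (lcompP S T).

Lemma strong_idm (S : lfun) : strong (S := S) (fun Z => idm (S Z)).
Proof. exact/strong_id/eob_tens. Qed.

Lemma strong_whiskerl (S T : efun) (K : lfun) (f : forall Z, mor (S Z) (T Z)) :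
  strong f -> strong (S := ecomp K S) (T := ecomp K T) (fun Z => emo K (f Z)).
Proof. by move=> fs Z W; rewrite emo_tens; exact: pack_emo. Qed.

Lemma strong_whiskerr (S T : efun) (K : lfun) (f : forall Z, mor (S Z) (T Z)) :
  strong f -> strong (S := ecomp S K) (T := ecomp T K) (fun Z => f (K Z)).
Proof.
by move=> fs Z W; rewrite fs; apply: pack_family; exact: eob_tens.
Qed.

Lemma strongE (S T : efun) (f : forall Z, mor (S Z) (T Z)) Z :
  strong f -> f Z ≈ f tunit ⊠ idm Z.
Proof.
by move=> ->; apply: pack_family; rewrite tens1X.
Qed.

(** Strength makes [f] the family [f tunit ⊠ Z], whence naturality is the
    interchange law of [⊗]. *)
Lemma strong_nat (S T : lfun) (f : forall Z, mor (S Z) (T Z)) Z W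
    (g : mor Z W) : strong f -> f W ∘ emo S g = emo T g ∘ f Z.
Proof.
case: S T f => s [X eX] [t [Y eY]]; subst s t => /= f fs; apply: pack_inj.
have emoE V : idm V ⊠ g ≈ idm (V ⊗ tunit) ⊠ g.
  by apply: pack_tens => //; apply: pack_id; rewrite tensX1.
transitivity (pack (f tunit ⊠ g)).
  rewrite (pack_comp (emoE X) (strongE W fs)).
  by rewrite -tensm_comp comp1m compm1.
rewrite (pack_comp (strongE Z fs) (emoE Y)).
by rewrite -tensm_comp comp1m compm1.
Qed.

End TensoringFunctors.

(** * Bimodule transformations *)

Section Bimodules.
Variable A : strictcat.
Implicit Types (X Y S T : lfun A) (Z W : A).

Record frobmonad := FrobMonad {
  fmT :> lfun A;
  mu : forall Z, mor (fmT (fmT Z)) (fmT Z);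
  eta : forall Z, mor Z (fmT Z);
  delta : forall Z, mor (fmT Z) (fmT (fmT Z));
  counit : forall Z, mor (fmT Z) Z;
  mu_strong : strong (S := ecomp fmT fmT) mu;
  eta_strong : strong (S := eid A) eta;
  delta_strong : strong (T := ecomp fmT fmT) delta;
  counit_strong : strong (T := eid A) counit;
  muA : forall Z, mu Z ∘ mu (fmT Z) = mu Z ∘ emo fmT (mu Z);
  mu_etal : forall Z, mu Z ∘ eta (fmT Z) = idm (fmT Z);
  mu_etar : forall Z, mu Z ∘ emo fmT (eta Z) = idm (fmT Z);
  deltaA : forall Z, delta (fmT Z) ∘ delta Z = emo fmT (delta Z) ∘ delta Z;
  delta_counitl : forall Z, counit (fmT Z) ∘ delta Z = idm (fmT Z);
  delta_counitr : forall Z, emo fmT (counit Z) ∘ delta Z = idm (fmT Z);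
  frobl : forall Z, mu (fmT Z) ∘ emo fmT (delta Z) = delta Z ∘ mu Z;
  frobr : forall Z, emo fmT (mu Z) ∘ delta (fmT Z) = delta Z ∘ mu Z }.

Implicit Types M N L : frobmonad.

Lemma mu_nat M Z W (f : mor Z W) :
  mu M W ∘ emo M (emo M f) = emo M f ∘ mu M Z.
Proof. exact: (strong_nat (S := lcomp M M) f (mu_strong M)). Qed.

(** A morphism of right [N]-module functors [S N -> T N] commutes with
    left [N]-module morphisms, since [h] is determined by [h ∘ eta]. *)
Lemma module_exchange N S T (f : forall Z, mor (S (N Z)) (T (N Z))) Z W
    (h : mor (N Z) (N W)) :
  strong (S := ecomp S N) (T := ecomp T N) f ->
  (forall V, f V ∘ emo S (mu N V) = emo T (mu N V) ∘ f (N V)) ->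
  h ∘ mu N Z = mu N W ∘ emo N h ->
  f W ∘ emo S h = emo T h ∘ f Z.
Proof.
move=> fs fmod hmod.
have -> : h = mu N W ∘ emo N (h ∘ eta N Z).
  by rewrite emo_comp compA -hmod -compA mu_etar compm1.
rewrite !(emo_comp _ (mu N W)) !compA fmod -!compA; congr comp.
exact: (strong_nat (S := lcomp S N) (T := lcomp T N) _ fs).
Qed.

(** Strength stands in for naturality, which follows from it. *)
Record bimor M N X Y := Bimor {
  bfam :> forall Z, mor (M (X (N Z))) (M (Y (N Z)));
  bfam_strong : strong (S := ecomp M (ecomp X N)) (T := ecomp M (ecomp Y N))
    bfam;
  bfam_modl : forall Z,
    bfam Z ∘ mu M (X (N Z)) = mu M (Y (N Z)) ∘ emo M (bfam Z);
  bfam_modr : forall Z, bfam Z ∘ emo M (emo X (mu N Z))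
    = emo M (emo Y (mu N Z)) ∘ bfam (N Z) }.

Lemma bimor_eq M N X Y (f g : bimor M N X Y) : (forall Z, f Z = g Z) -> f = g.
Proof.
case: f g => f f1 f2 f3 [g g1 g2 g3] /= fg.
have e : f = g by exact: functional_extensionality_dep.
by subst g; congr Bimor; exact: Prop_irrelevance.
Qed.

Lemma bimor_nat M N X Y (f : bimor M N X Y) Z W (g : mor Z W) :
  f W ∘ emo M (emo X (emo N g)) = emo M (emo Y (emo N g)) ∘ f Z.
Proof.
exact: (strong_nat (S := lcomp M (lcomp X N)) (T := lcomp M (lcomp Y N)) g
  (bfam_strong f)).
Qed.

(** This is the interchange law over the shared middle monad: [f] is right linear and [g] left
    linear over [N], so they commute although both act on that factor. *)
Lemma bimor_exchange M N L X Y S T (f : bimor M N X Y) (g : bimor N L S T) Z :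
  f (T (L Z)) ∘ emo M (emo X (g Z)) = emo M (emo Y (g Z)) ∘ f (S (L Z)).
Proof.
exact: (module_exchange (S := lcomp M X) (T := lcomp M Y) (bfam_strong f)
  (bfam_modr f) (bfam_modl g Z)).
Qed.

Definition bimor_id M N X : bimor M N X X.
Proof.
refine (@Bimor M N X X (fun Z => idm (M (X (N Z)))) _ _ _) => [|Z|Z].
- exact: (strong_idm (lcomp M (lcomp X N))).
- by rewrite emo_id comp1m compm1.
- by rewrite comp1m compm1.
Defined.

Definition bimor_comp M N X Y T (g : bimor M N Y T) (f : bimor M N X Y) :
  bimor M N X T.
Proof.
refine (@Bimor M N X T (fun Z => g Z ∘ f Z) _ _ _) => [|Z|Z].
- exact: strong_comp (bfam_strong g) (bfam_strong f).
- by rewrite emo_comp compA -bfam_modl -!compA bfam_modl.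
- by rewrite compA -bfam_modr -!compA bfam_modr.
Defined.

Definition bimcat M N : cat.
Proof.
refine (@Cat (lfun A) (bimor M N) (@bimor_id M N) (@bimor_comp M N) _ _ _).
- by move=> X Y f; apply: bimor_eq => Z /=; rewrite comp1m.
- by move=> X Y f; apply: bimor_eq => Z /=; rewrite compm1.
- by move=> X Y Z W h g f; apply: bimor_eq => V /=; rewrite compA.
Defined.

Lemma bfam_idhom M N (X Y : bimcat M N) (e : X = Y) Z :
  bfam (idhom e) Z ≈ idm (M (X (N Z))).
Proof. by case: _ / e. Qed.

Lemma bimor_idhom M N (X Y : bimcat M N) (f : mor X Y) (e : X = Y) :
  (forall Z, f Z ≈ idm (M (X (N Z)))) -> f = idhom e.
Proof.
move=> fE; apply: bimor_eq => Z; apply: pack_inj.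
by rewrite fE bfam_idhom.
Qed.

(** The tensor product over [N] of maps of free bimodules. One copy of [N] is shared: [g] acts on it
    first and [f] afterwards, the order being immaterial by [bimor_exchange]. *)
Definition bimor_tens M N L (X X' S S' : lfun A) (f : bimor M N X X')
  (g : bimor N L S S') : bimor M L (lcomp X (lcomp N S)) (lcomp X' (lcomp N S')).
Proof.
refine (@Bimor M L (lcomp X (lcomp N S)) (lcomp X' (lcomp N S'))
  (fun Z => f (S' (L Z)) ∘ emo M (emo X (g Z))) _ _ _) => [|Z|Z] /=.
- apply: (strong_comp (T := lcomp M (lcomp X (lcomp N (lcomp S' L))))).
    exact: (strong_whiskerr (lcomp S' L) (bfam_strong f)).
  exact: (strong_whiskerl (lcomp M X) (bfam_strong g)).
- by rewrite emo_comp compA -bfam_modl -!compA mu_nat.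
- rewrite -compA -!emo_comp bfam_modr !emo_comp !compA; congr comp.
  exact: (strong_nat (S := lcomp M (lcomp X N)) (T := lcomp M (lcomp X' N)) _
    (bfam_strong f)).
Defined.

Definition free_bimor M N S T (h : forall Z, mor (S Z) (T Z))
  (hs : strong h) : bimor M N S T.
Proof.
refine (@Bimor M N S T (fun Z => emo M (h (N Z))) _ _ _) => [|Z|Z].
- exact: (strong_whiskerl M (strong_whiskerr N hs)).
- by rewrite mu_nat.
- by rewrite -!emo_comp (strong_nat _ hs).
Defined.

End Bimodules.

(** * Identity 2-arrows along equalities of 1-arrows *)

Lemma pack_id_comp (C : cat) (U V : C) (h : mor U V) (k : mor V U) :
  h ≈ idm U -> k ≈ idm V -> k ∘ h = idm U.
Proof.
move=> eh ek; have eUV := congr1 (fun p => projT1 (projT2 p)) eh.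
by rewrite /= in eUV; subst V; rewrite (pack_inj eh) (pack_inj ek) compm1.
Qed.

Section StrictIso.
Variables (A : strictcat) (M N : frobmonad A).
Implicit Types X Y : lfun A.

Lemma strict_family X Y (f : forall Z, mor (M (X (N Z))) (M (Y (N Z))))
    (e : X = Y) : (forall Z, f Z ≈ idm (M (X (N Z)))) ->
  f = bfam (@idhom (bimcat M N) X Y e).
Proof.
move=> fE; apply: functional_extensionality_dep => Z; apply: pack_inj.
by rewrite fE bfam_idhom.
Qed.

(** The bimodule laws are inherited from [idhom e], whose family equals [f]; the explicit [f] is
    kept as the underlying family so that components still compute. *)
Definition bimor_strict X Y (f : forall Z, mor (M (X (N Z))) (M (Y (N Z))))
    (e : X = Y) (fE : forall Z, f Z ≈ idm (M (X (N Z)))) : bimor M N X Y.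
Proof.
by refine (@Bimor A M N X Y f _ _ _); rewrite (strict_family e fE);
  case: (@idhom (bimcat M N) X Y e).
Defined.

Definition bimiso_strict X Y (f : forall Z, mor (M (X (N Z))) (M (Y (N Z))))
    (g : forall Z, mor (M (Y (N Z))) (M (X (N Z)))) (e : X = Y)
    (fE : forall Z, f Z ≈ idm (M (X (N Z))))
    (gE : forall Z, g Z ≈ idm (M (Y (N Z)))) : @iso (bimcat M N) X Y.
Proof.
refine (@Iso (bimcat M N) X Y (bimor_strict e fE) (bimor_strict (esym e) gE)
  _ _); apply: bimor_eq => Z.
- - exact: pack_id_comp (fE Z) (gE Z).
- exact: pack_id_comp (gE Z) (fE Z).
Defined.

Lemma bimiso_strictE X Y f g e fE gE :
  fwd (@bimiso_strict X Y f g e fE gE) = @idhom (bimcat M N) X Y e.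
Proof. exact: bimor_idhom. Qed.

End StrictIso.

(** * The almost-2-category of free bimodules *)

Section BimoduleBicategory.
Variables (A : strictcat) (K : Type) (M : K -> frobmonad A).
Implicit Types a b c d : K.

Lemma bim_lcompA c b (X Y Z : lfun A) :
  lcomp (lcomp X (lcomp (M c) Y)) (lcomp (M b) Z)
  = lcomp X (lcomp (M c) (lcomp Y (lcomp (M b) Z))).
Proof. exact: lfun_eq. Qed.

Definition bimassoc d c b a (X : bimcat (M d) (M c)) (Y : bimcat (M c) (M b))
    (Z : bimcat (M b) (M a)) :
  @iso (bimcat (M d) (M a)) (lcomp (lcomp X (lcomp (M c) Y)) (lcomp (M b) Z))
    (lcomp X (lcomp (M c) (lcomp Y (lcomp (M b) Z)))) :=
  @bimiso_strict A (M d) (M a) (lcomp (lcomp X (lcomp (M c) Y)) (lcomp (M b) Z))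
    (lcomp X (lcomp (M c) (lcomp Y (lcomp (M b) Z))))
    (fun=> idm _) (fun=> idm _)
    (@bim_lcompA c b X Y Z) (fun=> erefl) (fun=> erefl).

Definition bimbicat : semibicat.
Proof.
refine (@SemiBicat K (fun b a => bimcat (M b) (M a))
  (fun c b a (X Y : lfun A) => lcomp X (lcomp (M b) Y))
  (fun c b a X X' Y Y' f g => bimor_tens f g) bimassoc _ _ _ _).
- by move=> c b a X Y; apply: bimor_eq => Z /=; rewrite !emo_id compm1.
- move=> c b a X X' X'' Y Y' Y'' f' f g' g; apply: bimor_eq => Z /=.
  by rewrite !emo_comp !compA; congr comp; rewrite -!compA bimor_exchange.
- move=> d c b a X X' Y Y' Z Z' f g h; apply: bimor_eq => W /=.
  by rewrite comp1m compm1 !emo_comp !compA.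
- move=> e d c b a X Y Z W; apply: bimor_eq => V /=.
  by rewrite !emo_id !compm1.
Defined.

Definition bima2cat : almost2cat.
Proof.
refine (@Almost2Cat bimbicat _) => d c b a X Y Z.
by eexists; exact: bimiso_strictE.
Defined.

End BimoduleBicategory.

(** * The monad of a Frobenius algebra *)

Section FrobeniusMonads.
Variable A : strictcat.
Implicit Types X Y Z : A.

Lemma comp_pack_id X Y Z (f : mor Y Z) (i : mor X Y) : i ≈ idm X -> f ∘ i ≈ f.
Proof. by case/idhom_pack => e ->; exact: comp_idhom. Qed.

Lemma id_comp_pack X Y Z (i : mor Y Z) (f : mor X Y) : i ≈ idm Y -> i ∘ f ≈ f.
Proof. by case/idhom_pack => e ->; exact: idhom_comp. Qed.

Lemma pack_id_compE X Y Z (g : mor Y Z) (f : mor X Y) :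
  g ≈ idm Y -> f ≈ idm X -> g ∘ f ≈ idm X.
Proof. by move=> eg ef; rewrite id_comp_pack. Qed.

Lemma pack_id_tens X Y X' Y' (f : mor X Y) (g : mor X' Y') :
  f ≈ idm X -> g ≈ idm X' -> f ⊠ g ≈ idm (X ⊗ X').
Proof. by move=> ef eg; rewrite (pack_tens ef eg) tensm_id. Qed.

Definition family (S T : efun A) X Y (f : mor X Y)
    (eS : forall Z, X ⊗ Z = S Z) (eT : forall Z, Y ⊗ Z = T Z) Z :
    mor (S Z) (T Z) :=
  cast (eS Z) (eT Z) (f ⊠ idm Z).

Lemma strong_family (S T : efun A) X Y (f : mor X Y) eS eT :
  strong (@family S T X Y f eS eT).
Proof.
move=> Z W; rewrite pack_cast (pack_tens (pack_cast _ _ _) (erefl _)).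
by rewrite tensmA tensm_id.
Qed.

(** A component [p] is represented by [f] when [p ≈ f ⊠ idm Z]. The [rep_] lemmas compute
    representatives of composites and whiskerings, so that each monad law is reduced to the
    corresponding law of the algebra. *)
Lemma rep_comp U V W X Y X' Z (p : mor U V) (q : mor V W) (f : mor X Y)
    (g : mor Y X') :
  p ≈ f ⊠ idm Z -> q ≈ g ⊠ idm Z -> q ∘ p ≈ (g ∘ f) ⊠ idm Z.
Proof.
move=> ep eq; rewrite (pack_comp ep eq).
by rewrite -tensm_comp comp1m.
Qed.

Lemma rep_pack U V X Y X' Y' Z (p : mor U V) (f : mor X Y) (g : mor X' Y') :
  p ≈ f ⊠ idm Z -> f ≈ g -> p ≈ g ⊠ idm Z.
Proof. by move=> -> e; exact: pack_tens. Qed.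

Lemma rep_eq U V X Y X' Y' Z (p q : mor U V) (f : mor X Y) (g : mor X' Y') :
  p ≈ f ⊠ idm Z -> q ≈ g ⊠ idm Z -> f ≈ g -> p = q.
Proof.
move=> ep eq efg; apply: pack_inj; rewrite ep eq.
exact: pack_tens.
Qed.

Lemma rep_whiskerr U V X Y Z L (p : mor U V) (f : mor X Y) :
  p ≈ f ⊠ idm (L ⊗ Z) -> p ≈ (f ⊠ idm L) ⊠ idm Z.
Proof. by move=> ->; rewrite tensmA tensm_id. Qed.

Lemma rep_whiskerl U V X Y Z L (p : mor U V) (f : mor X Y) :
  p ≈ f ⊠ idm Z -> idm L ⊠ p ≈ (idm L ⊠ f) ⊠ idm Z.
Proof. by move=> ep; rewrite tensmA; exact: pack_tens. Qed.

Lemma rep_id X Z : idm (X ⊗ Z) ≈ idm X ⊠ idm Z.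
Proof. by rewrite tensm_id. Qed.

Section OfFrobenius.
Variables (l : A) (V : mor tunit l) (V' : mor l tunit) (W : mor l (l ⊗ l))
  (W' : mor (l ⊗ l) l).
Hypothesis frob : is_frobenius (FrobData V V' W W').

Let tensl Z : (l ⊗ l) ⊗ Z = ecomp (canon l) (canon l) Z := tensA l l Z.
Let tens1 Z : tunit ⊗ Z = eid A Z := tens1X Z.
Let fmu := family (T := canon l) W' tensl (fun=> erefl).
Let feta := family (T := canon l) V tens1 (fun=> erefl).
Let fdelta := family (S := canon l) W (fun=> erefl) tensl.
Let fcounit := family (S := canon l) V' (fun=> erefl) tens1.

Let fmuE Z : fmu Z ≈ W' ⊠ idm Z. Proof. exact: pack_cast. Qed.
Let fetaE Z : feta Z ≈ V ⊠ idm Z. Proof. exact: pack_cast. Qed.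
Let fdeltaE Z : fdelta Z ≈ W ⊠ idm Z. Proof. exact: pack_cast. Qed.
Let fcounitE Z : fcounit Z ≈ V' ⊠ idm Z. Proof. exact: pack_cast. Qed.

Definition monad_of_frob : frobmonad A.
Proof.
refine (@FrobMonad A (lcanon l) fmu feta fdelta fcounit
  (strong_family _ _ _) (strong_family _ _ _) (strong_family _ _ _)
  (strong_family _ _ _) _ _ _ _ _ _ _ _) => Z;
  case: frob => h1 h2 [h3 h3'] [h4 h4'] [h5 h5'].
- apply: rep_eq (rep_comp (rep_whiskerr (fmuE (l ⊗ Z))) (fmuE Z))
    (rep_comp (rep_whiskerl l (fmuE Z)) (fmuE Z)) _.
  by rewrite h2 comp_pack_id ?pack_tassoc.
- apply: rep_eq (rep_comp (rep_whiskerr (fetaE (l ⊗ Z))) (fmuE Z))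
    (rep_id l Z) _.
  by rewrite -(comp_pack_id (W' ∘ (V ⊠ idm l)) (pack_tlunitV l)) h4.
- apply: rep_eq (rep_comp (rep_whiskerl l (fetaE Z)) (fmuE Z)) (rep_id l Z) _.
  by rewrite -(comp_pack_id (W' ∘ (idm l ⊠ V)) (pack_trunitV l)) h4'.
- apply: rep_eq (rep_comp (fdeltaE Z) (rep_whiskerr (fdeltaE (l ⊗ Z))))
    (rep_comp (fdeltaE Z) (rep_whiskerl l (fdeltaE Z))) _.
  by rewrite -(id_comp_pack ((W ⊠ idm l) ∘ W) (pack_tassoc l l l)) compA h1.
- apply: rep_eq (rep_comp (fdeltaE Z) (rep_whiskerr (fcounitE (l ⊗ Z))))
    (rep_id l Z) _.
  by rewrite -(id_comp_pack ((V' ⊠ idm l) ∘ W) (pack_tlunit l)) compA h3.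
- apply: rep_eq (rep_comp (fdeltaE Z) (rep_whiskerl l (fcounitE Z)))
    (rep_id l Z) _.
  by rewrite -(id_comp_pack ((idm l ⊠ V') ∘ W) (pack_trunit l)) compA h3'.
(* The Frobenius law of the algebra contains an associativity constraint, which has to be built into
   the representative of this component; likewise in the next case. *)
- have fmu'E : fmu (l ⊗ Z) ≈ ((W' ⊠ idm l) ∘ bwd (tassoc l l l)) ⊠ idm Z.
    apply: rep_pack (rep_whiskerr (fmuE (l ⊗ Z))) _.
    by rewrite comp_pack_id ?pack_tassocV.
  apply: rep_eq (rep_comp (rep_whiskerl l (fdeltaE Z)) fmu'E)
    (rep_comp (fmuE Z) (fdeltaE Z)) _.
  by rewrite h5.
- have fdelta'E : fdelta (l ⊗ Z) ≈ (tassoc l l l ∘ (W ⊠ idm l)) ⊠ idm Z.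
    apply: rep_pack (rep_whiskerr (fdeltaE (l ⊗ Z))) _.
    by rewrite id_comp_pack ?pack_tassoc.
  apply: rep_eq (rep_comp fdelta'E (rep_whiskerl l (fmuE Z)))
    (rep_comp (fmuE Z) (fdeltaE Z)) _.
  by rewrite h5' compA.
Defined.

End OfFrobenius.

Lemma frobdataP (F : frobenius A) :
  is_frobenius (FrobData (fr_V F) (fr_V' F) (fr_W F) (fr_W' F)).
Proof. by case: F => [[l V V' W W'] P]. Qed.

Definition frobmon (F : frobenius A) : frobmonad A :=
  monad_of_frob (frobdataP F).

Lemma mu_frobmon F Z : mu (frobmon F) Z ≈ fr_W' F ⊠ idm Z.
Proof. exact: pack_cast. Qed.

Lemma delta_frobmon F Z : delta (frobmon F) Z ≈ fr_W F ⊠ idm Z.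
Proof. exact: pack_cast. Qed.

Definition idmonad : frobmonad A.
Proof.
by refine (@FrobMonad A (lid A) (fun Z => idm Z) (fun Z => idm Z)
  (fun Z => idm Z) (fun Z => idm Z) (strong_idm (lid A)) (strong_idm (lid A))
  (strong_idm (lid A)) (strong_idm (lid A)) _ _ _ _ _ _ _ _) => //= Z;
  rewrite comp1m.
Defined.

Definition idbimor (S T : lfun A) (f : forall Z, mor (S Z) (T Z))
  (fs : strong f) : bimor idmonad idmonad S T.
Proof.
refine (@Bimor A idmonad idmonad S T f _ _ _) => [|Z|Z] /=.
- exact: fs.
- by rewrite comp1m compm1.
- by rewrite !emo_id comp1m compm1.
Defined.

Lemma strong_tens X Y (f : mor X Y) :
  strong (S := canon X) (T := canon Y) (fun Z => f ⊠ idm Z).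
Proof. by move=> Z W; rewrite tensmA tensm_id. Qed.

End FrobeniusMonads.

(** * The given tensor category as [HOM(A,A)] *)

Section FrobeniusBicategory.
Variables (A : strictcat) (N : frobmonad A).

(** [true] and [false] stand for the objects [A] and [B]. *)
Definition abmonad (b : bool) : frobmonad A := if b then idmonad A else N.

Definition ab_a2cat : almost2cat := bima2cat abmonad.

Lemma lcomp1X (X : lfun A) : lcomp (lid A) (lcomp (lid A) X) = X.
Proof. by apply: lfun_eq; case: X => -[]. Qed.

Lemma lcompX1 (X : lfun A) : lcomp X (lcomp (lid A) (lid A)) = X.
Proof. by apply: lfun_eq; case: X => -[]. Qed.

Definition unitA : @unit_at ab_a2cat true.
Proof.
refine (@UnitAt ab_a2cat true (lid A)
  (fun a X => @bimiso_strict A (idmonad A) (abmonad a)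
    (lcomp (lid A) (lcomp (lid A) X)) X (fun=> idm _) (fun=> idm _)
    (lcomp1X X) (fun=> erefl) (fun=> erefl))
  (fun c X => @bimiso_strict A (abmonad c) (idmonad A)
    (lcomp X (lcomp (lid A) (lid A))) X (fun=> idm _) (fun=> idm _)
    (lcompX1 X) (fun=> erefl) (fun=> erefl)) _ _ _).
- by move=> a X X' f; apply: bimor_eq => Z /=; rewrite !comp1m compm1.
- by move=> c X X' f; apply: bimor_eq => Z /=; rewrite !emo_id comp1m !compm1.
- by move=> c a X Y; apply: bimor_eq => Z /=; rewrite !emo_id !compm1.
Defined.

Lemma unitA_strict : strict_unit unitA.
Proof. by split=> a X; eexists; exact: bimiso_strictE. Qed.

Implicit Types X Y : A.

Definition embed_mor X Y (f : mor X Y) :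
    bimor (idmonad A) (idmonad A) (lcanon X) (lcanon Y) :=
  @idbimor A (lcanon X) (lcanon Y) _ (strong_tens f).

Definition embed_functor : functor A (@HOMu ab_a2cat true unitA).
Proof.
refine (@Functor A (HOMu unitA) (@lcanon A : A -> HOMu unitA) embed_mor _ _).
- by move=> X; apply: bimor_eq => Z /=; rewrite tensm_id.
- by move=> X Y Z g f; apply: bimor_eq => W /=; rewrite -tensm_comp comp1m.
Defined.

Lemma lcompE X Y : lcomp (lcanon X) (lcomp (lid A) (lcanon Y)) = lcanon (X ⊗ Y).
Proof.
apply/lfun_eq/efun_eq => [Z|Z W f] /=; first by rewrite tensA.
by rewrite -tensmA tensm_id.
Qed.

Lemma lidE : lid A = lcanon tunit.
Proof.
apply/lfun_eq/efun_eq => [Z|Z W f] /=; first by rewrite tens1X.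
by rewrite tensm1f.
Qed.

Definition embed2 X Y :
    @iso (HOMu unitA) (tens (embed_functor X) (embed_functor Y))
      (embed_functor (X ⊗ Y)) :=
  @bimiso_strict A (idmonad A) (idmonad A)
    (lcomp (lcanon X) (lcomp (lid A) (lcanon Y))) (lcanon (X ⊗ Y))
    (fun Z => bwd (tassoc X Y Z)) (fun Z => tassoc X Y Z)
    (lcompE X Y) (pack_tassocV X Y) (pack_tassoc X Y).

Definition embed0 : @iso (HOMu unitA) tunit (embed_functor tunit) :=
  @bimiso_strict A (idmonad A) (idmonad A) (lid A) (lcanon tunit)
    (fun Z => bwd (tlunit Z)) (@tlunit A) lidE
    (@pack_tlunitV A) (@pack_tlunit A).

Definition embed : tensor_functor A (@HOMu ab_a2cat true unitA).
Proof.
refine (@TensorFunctor A (HOMu unitA) embed_functor embed2 embed0 _ _ _ _).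
- move=> X X' Y Y' f g; apply: bimor_eq => Z; apply: pack_inj => /=.
  rewrite id_comp_pack ?pack_tassocV // [RHS]comp_pack_id ?pack_tassocV //.
  by rewrite -tensm_comp comp1m compm1 tensmA.
- move=> X Y Z; apply: bimor_eq => W; apply: pack_inj => /=.
  transitivity (pack (idm (X ⊗ (Y ⊗ (Z ⊗ W))))); last apply/esym;
    by do ?[apply: pack_id_compE|apply: pack_id_tens];
    rewrite ?pack_tassocV ?pack_tassoc.
- move=> X; apply: bimor_eq => W; apply: pack_inj => /=.
  by do ?[apply: pack_id_compE|apply: pack_id_tens];
    rewrite ?pack_tassocV ?pack_tlunitV ?pack_tlunit.
- move=> X; apply: bimor_eq => W; apply: pack_inj => /=.
  by do ?[apply: pack_id_compE|apply: pack_id_tens];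
    rewrite ?pack_tassocV ?pack_tlunitV ?pack_trunit.
Defined.

(** On objects [X] is recovered as the value of [canon X] at [tunit], by strictness of the unit. On
    morphisms strength recovers the whole family from its component at [tunit]. *)
Lemma embed_iso : functor_iso embed.
Proof.
split.
  exists (fun S : lfun A => S tunit) => [X|S] /=; first exact: tensX1.
  apply: lfun_eq; case: S => s [X eX]; subst s => /=.
  by rewrite tensX1.
move=> X Y; exists (fun f : bimor (idmonad A) (idmonad A) (lcanon X) (lcanon Y)
  => trunit Y ∘ f tunit ∘ bwd (trunit X)) => f.
  by rewrite /= trunit_nat -compA fwdK compm1.
apply: bimor_eq => Z; apply: pack_inj => /=.
rewrite (strongE Z (bfam_strong f)); apply: pack_tens => //.
by rewrite comp_pack_id ?pack_trunitV // id_comp_pack ?pack_trunit.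
Qed.

End FrobeniusBicategory.

(** * Linear structure *)

Section PulledBackModule.
Variables (K : nzRingType) (J : Type) (V : J -> lmodType K) (T : Type).
Variables (ev : T -> forall i, V i) (l : K -> T -> T -> T) (z : T).
Hypothesis ev_inj : forall f g, (forall i, ev f i = ev g i) -> f = g.
Hypothesis lE : forall k f g i, ev (l k f g) i = (k *: ev f i + ev g i)%R.
Hypothesis zE : forall i, ev z i = 0%R.
Local Open Scope ring_scope.

Let addA : associative (l 1).
Proof. by move=> f g h; apply: ev_inj => i; rewrite !lE !scale1r addrA. Qed.

Let addC : commutative (l 1).
Proof. by move=> f g; apply: ev_inj => i; rewrite !lE !scale1r addrC. Qed.

Let add0 : left_id z (l 1).
Proof. by move=> f; apply: ev_inj => i; rewrite lE zE scaler0 add0r. Qed.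

Let addN : left_inverse z (fun f => l (-1) f z) (l 1).
Proof.
by move=> f; apply: ev_inj => i; rewrite !lE zE addr0 scale1r scaleN1r addNr.
Qed.

Definition pullback_choiceType : choiceType :=
  HB.pack_for choiceType T (gen_eqMixin T) (gen_choiceMixin T).

(** The single operation [l k f g] stands for [k *: f + g]: addition is [l 1], the opposite of [f]
    is [l (-1) f z], and scaling is [l k f z]. All axioms are read off through the jointly injective
    evaluations [ev]. *)
Definition pullback_zmodType : zmodType :=
  HB.pack_for zmodType (Choice.sort pullback_choiceType)
    (GRing.isZmodule.Build (Choice.sort pullback_choiceType)
       addA addC add0 addN).

Let scl k (f : pullback_zmodType) : pullback_zmodType := l k f z.

Let sclA a b f : scl a (scl b f) = scl (a * b) f.
Proof. by apply: ev_inj => i; rewrite !lE zE !addr0 scalerA. Qed.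

Let scl1 : left_id 1 scl.
Proof. by move=> f; apply: ev_inj => i; rewrite lE zE addr0 scale1r. Qed.

Let sclDr : right_distributive scl +%R.
Proof.
by move=> k f g; apply: ev_inj => i; rewrite !lE zE !addr0 !scale1r scalerDr.
Qed.

Let sclDl f : {morph scl^~ f : a b / a + b}.
Proof.
by move=> a b; apply: ev_inj => i; rewrite !lE zE !addr0 !scale1r scalerDl.
Qed.

Definition pullback_lmodType : lmodType K :=
  HB.pack_for (lmodType K) (GRing.Zmodule.sort pullback_zmodType)
    (GRing.Zmodule_isLmodule.Build K (GRing.Zmodule.sort pullback_zmodType)
       sclA scl1 sclDr sclDl).

Lemma pullback_lmodE k (f g : pullback_lmodType) : k *: f + g = l k f g.
Proof.
transitivity (l 1 (l k f z) g) => //; apply: ev_inj => i.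
by rewrite !lE zE addr0 scale1r.
Qed.

End PulledBackModule.

Section Linearity.
Variables (R : realType) (A : tensor_cstar R).
Local Open Scope ring_scope.

Definition strictcat_of : strictcat := StrictCat (tcs_strict A).

Implicit Types (X Y Z W : strictcat_of) (k : R[i]).

Definition shom X Y : completeNormedModType R[i] := @bthom R A X Y.

Definition lin k X Y (f g : mor X Y) : mor X Y :=
  k *: (f : shom X Y) + (g : shom X Y).

Definition mor0 X Y : mor X Y := 0 : shom X Y.

Lemma lin_compl k X Y Z (h h' : mor Y Z) (f : mor X Y) :
  lin k h h' ∘ f = lin k (h ∘ f) (h' ∘ f).
Proof. exact: tcs_compl. Qed.

Lemma lin_compr k X Y Z (h : mor Y Z) (f f' : mor X Y) :
  h ∘ lin k f f' = lin k (h ∘ f) (h ∘ f').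
Proof. exact: tcs_compr. Qed.

Lemma lin_tensl k X X' Y Y' (f f' : mor X X') (g : mor Y Y') :
  lin k f f' ⊠ g = lin k (f ⊠ g) (f' ⊠ g).
Proof. exact: tcs_tensl. Qed.

Lemma lin_tensr k X X' Y Y' (f : mor X X') (g g' : mor Y Y') :
  f ⊠ lin k g g' = lin k (f ⊠ g) (f ⊠ g').
Proof. exact: tcs_tensr. Qed.

(** Bilinearity is expressed through [lin] alone; writing zero in this form makes preservation of
    zero by [∘] and [⊠] a case of it. *)
Lemma linN1 X Y (f : mor X Y) : lin (-1) f f = mor0 X Y.
Proof. by rewrite /lin scaleN1r addNr. Qed.

Lemma mor0_compl X Y Z (f : mor X Y) : mor0 Y Z ∘ f = mor0 X Z.
Proof. by rewrite -(linN1 (mor0 Y Z)) lin_compl linN1. Qed.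

Lemma mor0_compr X Y Z (h : mor Y Z) : h ∘ mor0 X Y = mor0 X Z.
Proof. by rewrite -(linN1 (mor0 X Y)) lin_compr linN1. Qed.

Lemma mor0_tensl X X' Y Y' (g : mor Y Y') :
  mor0 X X' ⊠ g = mor0 (X ⊗ Y) (X' ⊗ Y').
Proof. by rewrite -(linN1 (mor0 X X')) lin_tensl linN1. Qed.

Lemma mor0_tensr X X' Y Y' (f : mor X X') :
  f ⊠ mor0 Y Y' = mor0 (X ⊗ Y) (X' ⊗ Y').
Proof. by rewrite -(linN1 (mor0 Y Y')) lin_tensr linN1. Qed.

Lemma emo_lin (S : lfun strictcat_of) k X Y (f g : mor X Y) :
  emo S (lin k f g) = lin k (emo S f) (emo S g).
Proof. by case: S => s [V eV]; subst s; exact: lin_tensr. Qed.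

Lemma emo_mor0 (S : lfun strictcat_of) X Y :
  emo S (mor0 X Y) = mor0 (S X) (S Y).
Proof. by case: S => s [V eV]; subst s; exact: mor0_tensr. Qed.

Lemma pack_mor0 X Y X' Y' : X = X' -> Y = Y' -> mor0 X Y ≈ mor0 X' Y'.
Proof. by move=> -> ->. Qed.

Lemma pack_lin k X Y (f g : mor X Y) X' Y' (f' g' : mor X' Y') :
  f ≈ f' -> g ≈ g' -> lin k f g ≈ lin k f' g'.
Proof.
move=> ef; move: X' Y' f' ef g'.
apply: (pack_elim (P := fun X' Y' f' => forall g' : mor X' Y', g ≈ g' ->
  lin k f g ≈ lin k f' g')) => g' eg.
by rewrite (pack_inj eg).
Qed.

Section BimoduleMorphisms.
Variables (M N : frobmonad strictcat_of) (S T : lfun strictcat_of).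

Definition linb k (f g : bimor M N S T) : bimor M N S T.
Proof.
refine (@Bimor strictcat_of M N S T (fun Z => lin k (f Z) (g Z)) _ _ _)
  => [Z W|Z|Z].
- rewrite lin_tensl; apply: pack_lin; apply: (bfam_strong _ Z W).
- by rewrite emo_lin lin_compl lin_compr !bfam_modl.
- by rewrite lin_compl lin_compr !bfam_modr.
Defined.

Definition bimor0 : bimor M N S T.
Proof.
refine (@Bimor strictcat_of M N S T (fun Z => mor0 _ _) _ _ _) => [Z W|Z|Z].
- rewrite mor0_tensl; apply: pack_mor0.
    exact: (eob_tens (lcomp M (lcomp S N))).
  exact: (eob_tens (lcomp M (lcomp T N))).
- by rewrite emo_mor0 mor0_compl mor0_compr.
- by rewrite mor0_compl mor0_compr.
Defined.

Definition bimor_lmodType : lmodType R[i] :=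
  @pullback_lmodType R[i] strictcat_of
    (fun Z => shom (M (S (N Z))) (M (T (N Z)))) (bimor M N S T)
    (@bfam _ M N S T) linb bimor0 (@bimor_eq _ M N S T)
    (fun=> fun=> fun=> fun=> erefl) (fun=> erefl).

Lemma bimor_lmodE k (f g : bimor M N S T) :
  k *: (f : bimor_lmodType) + g = linb k f g.
Proof. exact: pullback_lmodE. Qed.

End BimoduleMorphisms.

Variable N : frobmonad strictcat_of.

Definition ab_linear2 : linear2 R[i] (ab_a2cat N).
Proof.
refine (@Linear2 R[i] (ab_a2cat N) (fun b a (X Y : lfun strictcat_of) =>
  GRing.Lmodule.class (bimor_lmodType (abmonad N b) (abmonad N a) X Y))
  _ _ _ _).
- move=> b a X Y Z k h h' f; cbv zeta.
  rewrite !bimor_lmodE; apply: bimor_eq => V /=; exact: lin_compl.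
- move=> b a X Y Z k h f f'; cbv zeta.
  rewrite !bimor_lmodE; apply: bimor_eq => V /=; exact: lin_compr.
- move=> c b a X X' Y Y' k f f' g; cbv zeta.
  rewrite !bimor_lmodE; apply: bimor_eq => V /=; exact: lin_compl.
- move=> c b a X X' Y Y' k f g g'; cbv zeta.
  rewrite !bimor_lmodE; apply: bimor_eq => V /=.
  by rewrite !emo_lin lin_compr.
Defined.

Lemma ab_l2_lin b a (X Y : lfun strictcat_of) k
    (f g : @bimor strictcat_of (abmonad N b) (abmonad N a) X Y) :
  @l2_lin _ _ ab_linear2 b a X Y k f g = linb k f g.
Proof. exact: bimor_lmodE. Qed.

End Linearity.

(** * The almost-2-category associated with a Frobenius algebra *)

Section Associated.
Variables (R : realType) (A : tensor_cstar R) (F : frobenius A).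

Definition frobmon_of : frobmonad (strictcat_of A) :=
  @frobmon (strictcat_of A) F.

(** Composition through [B] inserts the monad of the algebra between the two identity functors, so
    the functor data agree by conversion. *)
Lemma rhobrhoE :
  lcomp (lid _) (lcomp frobmon_of (lid _)) = lcanon (fr_ob F : strictcat_of A).
Proof. exact: lfun_eq. Qed.

Definition ab_associated : associated_a2cat F.
Proof.
refine (@AssociatedA2Cat R A F (ab_a2cat frobmon_of) true false _ _
  (unitA frobmon_of) (unitA_strict _) (embed frobmon_of) (embed_iso _)
  (lid _) (lid _) rhobrhoE (ab_linear2 frobmon_of) _) => //.
- by case; [left|right].
- move=> X Y k f g; rewrite ab_l2_lin; apply: bimor_eq => Z.
  exact: (@lin_tensl _ A).
Defined.

End Associated.

(** * Units in the completion *)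

Section CompletionUnits.
Variable A : strictcat.
Implicit Types (M N : frobmonad A) (X Y S T : lfun A) (Z : A).

(** Separability of the monad. The idempotent [sec ∘ mu] on the free bimodule [M M] has the unit
    bimodule [M] as its image, with [mu] and [sec] as projection and inclusion. *)
Record splitting M := Splitting {
  sec : forall Z, mor (M Z) (M (M Z));
  sec_strong : strong (T := ecomp M M) sec;
  mu_sec : forall Z, mu M Z ∘ sec Z = idm (M Z);
  sec_modl : forall Z, mu M (M Z) ∘ emo M (sec Z) = sec Z ∘ mu M Z;
  sec_modr : forall Z, emo M (mu M Z) ∘ sec (M Z) = sec Z ∘ mu M Z }.

Section Actions.
Variables M N : frobmonad A.

Definition actl X : bimor M N (lcomp (lid A) (lcomp M X)) X.
Proof.
refine (@Bimor A M N (lcomp (lid A) (lcomp M X)) X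
  (fun Z => mu M (X (N Z))) _ _ _) => [|Z|Z] /=.
- exact: (strong_whiskerr (lcomp X N) (mu_strong M)).
- exact: muA.
- exact: mu_nat.
Defined.

Definition actr X : bimor M N (lcomp X (lcomp N (lid A))) X.
Proof.
refine (@Bimor A M N (lcomp X (lcomp N (lid A))) X
  (fun Z => emo M (emo X (mu N Z))) _ _ _) => [|Z|Z] /=.
- exact: (strong_whiskerl (lcomp M X) (mu_strong N)).
- by rewrite mu_nat.
- by rewrite -!emo_comp muA.
Defined.

Definition secl (s : splitting M) X : bimor M N X (lcomp (lid A) (lcomp M X)).
Proof.
refine (@Bimor A M N X (lcomp (lid A) (lcomp M X))
  (fun Z => sec s (X (N Z))) _ _ _) => [|Z|Z] /=.
- exact: (strong_whiskerr (lcomp X N) (sec_strong s)).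
- by rewrite sec_modl.
- exact: (strong_nat (T := lcomp M M) _ (sec_strong s)).
Defined.

Definition secr (s : splitting N) X : bimor M N X (lcomp X (lcomp N (lid A))).
Proof.
refine (@Bimor A M N X (lcomp X (lcomp N (lid A)))
  (fun Z => emo M (emo X (sec s Z))) _ _ _) => [|Z|Z] /=.
- exact: (strong_whiskerl (lcomp M X) (sec_strong s)).
- by rewrite mu_nat.
- by rewrite -!emo_comp sec_modr.
Defined.

End Actions.

Variables (K : Type) (M : K -> frobmonad A) (s : forall b, splitting (M b)).
Implicit Types a b c : K.

Definition unit_proj b : bimor (M b) (M b) (lid A) (lid A).
Proof.
refine (@Bimor A (M b) (M b) (lid A) (lid A)
  (fun Z => sec (s b) Z ∘ mu (M b) Z) _ _ _) => [|Z|Z] /=.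
- exact: strong_comp (sec_strong (s b)) (mu_strong (M b)).
- by rewrite -compA muA emo_comp !compA sec_modl.
- by rewrite -compA -muA !compA sec_modr.
Defined.

Lemma unit_projP b : unit_proj b = bimor_comp (unit_proj b) (unit_proj b).
Proof.
apply: bimor_eq => Z /=.
by rewrite -!compA (compA (mu _ _) (sec _ _)) mu_sec comp1m.
Qed.

Definition unitarr b : karoubi (bimcat (M b) (M b)) :=
  @KarOb (bimcat (M b) (M b)) (lid A) (unit_proj b) (unit_projP b).

Lemma kbimor_eq b a (X Y : karoubi (bimcat (M b) (M a))) (f g : mor X Y) :
  (forall Z, bfam (sval f) Z = bfam (sval g) Z) -> f = g.
Proof. by move=> fg; apply/karhom_eq/bimor_eq. Qed.

Lemma kbimorPl b a (X Y : karoubi (bimcat (M b) (M a))) (f : mor X Y) Z :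
  bfam (kproj Y) Z ∘ bfam (sval f) Z = bfam (sval f) Z.
Proof. exact: (congr1 (fun g : bimor _ _ _ _ => g Z) (karhomPl f)). Qed.

Lemma kbimorPr b a (X Y : karoubi (bimcat (M b) (M a))) (f : mor X Y) Z :
  bfam (sval f) Z ∘ bfam (kproj X) Z = bfam (sval f) Z.
Proof. exact: (congr1 (fun g : bimor _ _ _ _ => g Z) (karhomPr f)). Qed.

Lemma kprojK b a (X : karoubi (bimcat (M b) (M a))) Z :
  bfam (kproj X) Z ∘ bfam (kproj X) Z = bfam (kproj X) Z.
Proof. exact: (kbimorPl (idm X)). Qed.

Definition kbimor b a (X Y : karoubi (bimcat (M b) (M a)))
    (f : bimor (M b) (M a) (kob X) (kob Y))
    (fl : forall Z, bfam (kproj Y) Z ∘ f Z = f Z)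
    (fr : forall Z, f Z ∘ bfam (kproj X) Z = f Z) : mor X Y :=
  @karhom_fix _ X Y f
    (bimor_eq (fl : forall Z, bimor_comp (kproj Y) f Z = f Z))
    (bimor_eq (fr : forall Z, bimor_comp f (kproj X) Z = f Z)).

Local Notation E := (completion (bimbicat M)).

(** The section is right linear by [sec_modr] and [f] is left linear, so [module_exchange] applies;
    [sec_exchr] is the mirror image. *)
Lemma sec_exchl b a X Y (f : bimor (M b) (M a) X Y) Z :
  emo (M b) (f Z) ∘ sec (s b) (X (M a Z)) = sec (s b) (Y (M a Z)) ∘ f Z.
Proof.
symmetry; apply: (module_exchange (S := lid A) (sec_strong (s b))) => [V|].
- by rewrite /= sec_modr.
- exact: bfam_modl.
Qed.

Lemma sec_exchr c b X Y (f : bimor (M c) (M b) X Y) Z :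
  f (M b Z) ∘ emo (M c) (emo X (sec (s b) Z))
  = emo (M c) (emo Y (sec (s b) Z)) ∘ f Z.
Proof.
apply: (module_exchange (S := lcomp (M c) X) (T := lcomp (M c) Y)
  (bfam_strong f)) => [V|]; first exact: bfam_modr.
by rewrite sec_modl.
Qed.

Section LeftUnit.
Variables (b a : K) (X : @bhom E b a).

(** The action of [M b], cut down by the projection of [X]. The projection [sec ∘ mu] of the unit is
    absorbed because [mu ∘ sec] is the identity. *)
Definition lunit_fwd : mor (@btens E b b a (unitarr b) X) X.
Proof.
refine (@kbimor b a (@btens E b b a (unitarr b) X) X
  (bimor_comp (kproj X) (actl (M b) (M a) (kob X))) _ _) => Z /=.
- by rewrite compA kprojK.
- rewrite -!compA (compA (mu _ _) (sec _ _)) mu_sec comp1m -bfam_modl compA.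
  by rewrite kprojK.
Defined.

Definition lunit_bwd : mor X (@btens E b b a (unitarr b) X).
Proof.
refine (@kbimor b a X (@btens E b b a (unitarr b) X)
  (bimor_comp (secl (M a) (s b) (kob X)) (kproj X)) _ _) => Z /=.
- rewrite -!compA (compA (emo _ _)) sec_exchl -!compA kprojK.
  by rewrite (compA (mu _ _)) mu_sec comp1m.
- by rewrite -compA kprojK.
Defined.

Definition lunit : iso (@btens E b b a (unitarr b) X) X.
Proof.
refine (@Iso _ (@btens E b b a (unitarr b) X) X lunit_fwd lunit_bwd _ _);
  apply: kbimor_eq => Z /=.
- by rewrite -!compA (compA (bfam _ _) (bfam _ _)) kprojK bfam_modl.
- by rewrite -!compA (compA (mu _ _)) mu_sec comp1m kprojK.
Defined.

End LeftUnit.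

Section RightUnit.
Variables (c b : K) (X : @bhom E c b).

Definition runit_fwd : mor (@btens E c b b X (unitarr b)) X.
Proof.
refine (@kbimor c b (@btens E c b b X (unitarr b)) X
  (bimor_comp (kproj X) (actr (M c) (M b) (kob X))) _ _) => Z /=.
- by rewrite compA kprojK.
- rewrite -!compA (compA (emo _ _) (bfam _ _)) -bfam_modr -!compA.
  by rewrite -!emo_comp compA (compA (mu _ _)) mu_sec comp1m kprojK.
Defined.

Definition runit_bwd : mor X (@btens E c b b X (unitarr b)).
Proof.
refine (@kbimor c b X (@btens E c b b X (unitarr b))
  (bimor_comp (secr (M c) (s b) (kob X)) (kproj X)) _ _) => Z /=.
- rewrite -!compA (compA _ _ (bfam _ _)) -!emo_comp -!compA mu_sec compm1 compA.
  by rewrite sec_exchr -compA kprojK.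
- by rewrite -compA kprojK.
Defined.

Definition runit : iso (@btens E c b b X (unitarr b)) X.
Proof.
refine (@Iso _ (@btens E c b b X (unitarr b)) X runit_fwd runit_bwd _ _);
  apply: kbimor_eq => Z /=.
- rewrite -!compA (compA (bfam _ _) (bfam _ _)) kprojK !emo_comp compA.
  by rewrite -sec_exchr -compA.
- rewrite -!compA (compA (emo _ _)) -!emo_comp mu_sec !emo_id comp1m.
  exact: kprojK.
Defined.

End RightUnit.

Lemma lunit_natE b a X X' (p : bimor (M b) (M a) X X)
    (p' : bimor (M b) (M a) X' X') (f : bimor (M b) (M a) X X') Z :
  p' Z ∘ f Z = f Z -> f Z ∘ p Z = f Z ->
  p' Z ∘ mu (M b) (X' (M a Z))
    ∘ (sec (s b) (X' (M a Z)) ∘ mu (M b) (X' (M a Z)) ∘ emo (M b) (f Z))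
  = f Z ∘ (p Z ∘ mu (M b) (X (M a Z))).
Proof.
move=> fl fr.
rewrite -!compA (compA (mu _ _) (sec _ _)) mu_sec comp1m -bfam_modl.
by rewrite !compA fl fr.
Qed.

Lemma runit_natE c b X X' (p : bimor (M c) (M b) X X)
    (p' : bimor (M c) (M b) X' X') (f : bimor (M c) (M b) X X') Z :
  p' Z ∘ f Z = f Z -> f Z ∘ p Z = f Z ->
  p' Z ∘ emo (M c) (emo X' (mu (M b) Z))
    ∘ (f (M b Z) ∘ emo (M c) (emo X (sec (s b) Z ∘ mu (M b) Z)))
  = f Z ∘ (p Z ∘ emo (M c) (emo X (mu (M b) Z))).
Proof.
move=> fl fr.
rewrite -!compA (compA (emo _ _) (bfam _ _)) -bfam_modr -!compA.
by rewrite -!emo_comp (compA (mu _ _)) mu_sec comp1m !compA fl fr.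
Qed.

Lemma unit_triangleE c b a X Y (p : bimor (M c) (M b) X X)
    (q : bimor (M b) (M a) Y Y) Z :
  p (Y (M a Z)) ∘ p (Y (M a Z)) = p (Y (M a Z)) -> q Z ∘ q Z = q Z ->
  p (Y (M a Z)) ∘ emo (M c) (emo X (q Z ∘ mu (M b) (Y (M a Z))))
    ∘ (p (M b (Y (M a Z)))
       ∘ emo (M c) (emo X (sec (s b) (Y (M a Z)) ∘ mu (M b) (Y (M a Z))
            ∘ emo (M b) (q Z)))
       ∘ idm (M c (X (M b (M b (Y (M a Z)))))))
  = p (Y (M a Z)) ∘ emo (M c) (emo X (mu (M b) (Y (M a Z))))
    ∘ emo (M c) (emo X (emo (M b) (q Z))).
Proof.
move=> pp qq; rewrite compm1 (emo_comp X (q Z)) (emo_comp (M c)) -!compA.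
(* Right linearity of [p] moves it past [mu], and interchange moves it past [q]. Then [pp] merges
   the two copies of [p], [mu ∘ sec] cancels, and [qq] merges the copies of [q]. *)
rewrite (compA (emo _ (emo _ (mu _ _))) (bfam _ _)) -bfam_modr -!compA.
rewrite (compA (emo _ (emo _ (bfam _ _))) (bfam _ _)) -bimor_exchange -!compA.
rewrite (compA (bfam _ _) (bfam _ _)) pp -!emo_comp.
rewrite (compA (mu _ _) (sec _ _)) mu_sec comp1m -bfam_modl.
by rewrite (compA (q Z)) qq.
Qed.

Definition completion_unit b : @unit_at E b.
Proof.
refine (@UnitAt E b (unitarr b)
  (fun a (X : @bhom E b a) => lunit X) (fun c (X : @bhom E c b) => runit X)
  _ _ _).
- move=> a X X' f; apply: kbimor_eq => Z /=.
  exact: lunit_natE (kbimorPl f Z) (kbimorPr f Z).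
- move=> c X X' f; apply: kbimor_eq => Z /=.
  exact: runit_natE (kbimorPl f Z) (kbimorPr f Z).
- move=> c a X Y; apply: kbimor_eq => Z /=.
  apply: unit_triangleE; exact: kprojK.
Defined.

End CompletionUnits.

(** * Sections of the multiplication of a Frobenius algebra *)

Section Splittings.
Variable A : strictcat.

Definition idmonad_splitting : splitting (idmonad A).
Proof.
by refine (@Splitting A (idmonad A) (fun Z => idm Z) (strong_idm (lid A))
  _ _ _) => Z /=; rewrite comp1m.
Defined.

Section OfInverse.
Variables (M : frobmonad A) (w : forall Z, mor (M Z) (M Z)).
Hypotheses (w_strong : strong w)
  (wK : forall Z, w Z ∘ (mu M Z ∘ delta M Z) = idm (M Z))
  (Kw : forall Z, (mu M Z ∘ delta M Z) ∘ w Z = idm (M Z)).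

(** The Frobenius laws make [mu ∘ delta] linear over [M] on both sides, and the inverse of a linear
    map is linear. *)
Let w_modl Z : w Z ∘ mu M Z = mu M Z ∘ emo M (w Z).
Proof.
rewrite -[LHS]compm1 -(emo_id M) -(Kw Z) !emo_comp -!compA.
rewrite (compA (mu M Z) (emo M (mu M Z))) -muA -!compA.
rewrite (compA _ (emo M (delta M Z))) frobl !compA.
by rewrite -(compA (w Z)) wK comp1m.
Qed.

Let w_modr Z : w Z ∘ mu M Z = mu M Z ∘ w (M Z).
Proof.
rewrite -[LHS]compm1 -(Kw (M Z)) -!compA (compA (mu M Z) (mu M (M Z))) muA.
rewrite -!compA (compA _ (delta M (M Z))) frobr !compA.
by rewrite -(compA (w Z)) wK comp1m.
Qed.

Definition splitting_of_inverse : splitting M.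
Proof.
refine (@Splitting A M (fun Z => delta M Z ∘ w Z) _ _ _ _) => [|Z|Z|Z].
- exact: strong_comp (delta_strong M) w_strong.
- by rewrite compA Kw.
- by rewrite emo_comp compA frobl -!compA w_modl.
- by rewrite compA frobr -!compA w_modr.
Defined.

End OfInverse.
End Splittings.

(** * C*-arguments: invertibility of [W' ∘ W] *)

Section CStar.
Variables (R : realType) (A : tensor_cstar R).
Local Open Scope ring_scope.
Implicit Types X Y Z : A.

Lemma compDl X Y Z (h h' : bthom Y Z) (f : mor X Y) :
  (h + h') ∘ f = (h ∘ f : bthom X Z) + (h' ∘ f : bthom X Z).
Proof. by have := tcs_compl 1 h h' f; rewrite !scale1r. Qed.

Lemma compDr X Y Z (h : mor Y Z) (f f' : bthom X Y) :
  h ∘ (f + f') = (h ∘ f : bthom X Z) + (h ∘ f' : bthom X Z).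
Proof. by have := tcs_compr 1 h f f'; rewrite !scale1r. Qed.

Lemma compNl X Y Z (h : bthom Y Z) (f : mor X Y) :
  (- h) ∘ f = - (h ∘ f : bthom X Z).
Proof.
apply: (addIr (h ∘ f : bthom X Z)); rewrite -compDl !addNr.
by have := mor0_compl (A := A) Z f.
Qed.

Lemma compNr X Y Z (h : mor Y Z) (f : bthom X Y) :
  h ∘ (- f) = - (h ∘ f : bthom X Z).
Proof.
apply: (addIr (h ∘ f : bthom X Z)); rewrite -compDr !addNr.
by have := mor0_compr (A := A) X h.
Qed.

Lemma starB X Y (f g : bthom X Y) :
  (f - g)^† = (f^† : bthom Y X) - (g^† : bthom Y X).
Proof.
have := star_antilinear (-1) g f; rewrite rmorphN1 !scaleN1r => e.
by rewrite addrC e addrC.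
Qed.

(** Otherwise [-1] would lie in the spectrum of the positive element [d^† ∘ d]. *)
Lemma one_add_star_inv X Y (d : mor X Y) :
  is_iso ((d^† ∘ d : bthom X X) + (idm X : bthom X X) : mor X X).
Proof.
apply: contrapT => ninv; have [_ /(_ (-1)) pos] := star_positive d.
suff /pos : ~ exists g : mor X X,
    let h : mor X X := (d^† ∘ d : bthom X X) - (-1) *: (idm X : bthom X X) in
    g ∘ h = idm X /\ h ∘ g = idm X.
  by rewrite oppr_ge0 ler10.
by case=> g; rewrite /= scaleN1r opprK => gi; apply: ninv; exists g.
Qed.

Lemma star_id X : (idm X)^† = idm X.
Proof.
by rewrite -[RHS]star_invol -[(idm X)^†]compm1 star_comp star_invol compm1.
Qed.

(** With [e = x ∘ y] idempotent and [z = 1 + (e^† - e)^† (e^† - e)],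
    [e z = e e^† e = z e], so that [y z x = (y y^†)(x^† x)] has the inverse
    [y z^-1 x] (Kaplansky's argument for idempotents in C*-algebras). *)
Lemma star_square_iso X Y (x : mor X Y) (y : mor Y X) :
  y ∘ x = idm X -> is_iso (x^† ∘ x).
Proof.
move=> yx; pose e := x ∘ y.
pose d : mor Y Y := (e^† : bthom Y Y) - (e : bthom Y Y).
have ee : e ∘ e = e by rewrite /e -compA (compA y) yx comp1m.
have ss : e^† ∘ e^† = e^† by rewrite -star_comp ee.
have [g [gz zg]] := one_add_star_inv d.
pose z : mor Y Y := (d^† ∘ d : bthom Y Y) + (idm Y : bthom Y Y).
rewrite -/z in gz zg.
have dE : d^† = (e : bthom Y Y) - (e^† : bthom Y Y) by rewrite starB star_invol.
have ez : e ∘ z = e ∘ e^† ∘ e.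
  rewrite /z dE /d compDr compm1 compDl !compDr !compNl !compNr.
  rewrite (compA e e) !ee ss opprK addrACA subrr add0r addrAC addNr add0r.
  exact: compA.
have ze : z ∘ e = e ∘ e^† ∘ e.
  rewrite /z dE /d compDl comp1m -compA !compDl !compDr !compNl !compNr.
  rewrite (compA e^† e^†) !ee ss opprK addNr addr0 subrK.
  exact: compA.
have {}gz : y ∘ g ∘ x ∘ (y ∘ y^†) ∘ (x^† ∘ x) = idm X.
  have -> : (y ∘ g ∘ x) ∘ (y ∘ y^†) ∘ (x^† ∘ x) = y ∘ g ∘ (e ∘ e^† ∘ e) ∘ x.
    by rewrite /e star_comp -!compA yx compm1.
  by rewrite -ze (compA (y ∘ g)) -(compA y g z) gz compm1 /e -!compA yx compm1 yx.
set w := y ∘ g ∘ x ∘ (y ∘ y^†) in gz; exists w; split=> //.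
(* So far [w] is a left inverse. As [x^† ∘ x] is self-adjoint, the adjoint of [w] is a right
   inverse, and then [w] is two-sided. *)
have uw' : x^† ∘ x ∘ w^† = idm X.
  by rewrite -[RHS]star_id -gz star_comp (star_comp x^†) star_invol.
by rewrite -[LHS]compm1 -{1}uw' compA -(compA _ w) gz compm1.
Qed.

Lemma star_frobenius_iso (F : frobenius A) : star_frobenius F ->
  is_iso (fr_W' F ∘ fr_W F).
Proof.
move=> [_ ->]; have [_ _ [VW _] _ _] := @frobdataP (strictcat_of A) F.
exact: star_square_iso VW.
Qed.

(** The inverse of [W' ∘ W] is only known to exist and is chosen by [cid]. From here on only the
    laws recorded in [splitting] are used. *)
Lemma frobmon_splitting (F : frobenius A) : star_frobenius F ->
  splitting (frobmon_of F).
Proof.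
move=> hF; have [w [wK Kw]] := cid (star_frobenius_iso hF).
have mudelta Z : mu (frobmon_of F) Z ∘ delta (frobmon_of F) Z
    = ((fr_W' F ∘ fr_W F) ⊠ idm Z : @mor (strictcat_of A) _ _).
  apply: pack_inj; exact: rep_comp (@delta_frobmon (strictcat_of A) F Z)
    (@mu_frobmon (strictcat_of A) F Z).
apply: (@splitting_of_inverse _ (frobmon_of F)
  (fun Z => w ⊠ idm Z : @mor (strictcat_of A) _ _)) => [Z W|Z|Z].
- by rewrite tensmA tensm_id.
- by rewrite mudelta -tensm_comp wK comp1m tensm_id.
- by rewrite mudelta -tensm_comp Kw comp1m tensm_id.
Qed.

Definition absplitting (F : frobenius A) (hF : star_frobenius F) b :
    splitting (abmonad (frobmon_of F) b) :=
  match b return splitting (abmonad (frobmon_of F) b) with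
  | true => idmonad_splitting _
  | false => frobmon_splitting hF
  end.

Definition ab_unit (F : frobenius A) (hF : star_frobenius F)
    (a : completion (ab_associated F)) : unit_at a :=
  completion_unit (absplitting hF) a.

End CStar.

(** * The embedding and the conjugation relations *)

Section CompletedEmbedding.
Variables (A : strictcat) (N : frobmonad A).
Variable s : forall b, splitting (abmonad N b).
Local Notation M := (abmonad N).
Local Notation E := (@Bicat (completion (bimbicat M)) (completion_unit s)).
Local Notation oA := (true : E).
Local Notation oB := (false : E).

Definition kfull b a (X : lfun A) : karoubi (bimcat (M b) (M a)) :=
  @KarOb (bimcat (M b) (M a)) X (idm _) (esym (comp1m _)).

(** A predicate rather than equality with [kfull]: the projection of a tensor product, or of the
    unit at [A], is equal to an identity without being convertible to it. *)
Definition full b a (X : karoubi (bimcat (M b) (M a))) : Prop :=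
  forall Z, bfam (kproj X) Z = idm _.

Lemma full_compl b a (X Y : karoubi (bimcat (M b) (M a))) : full Y ->
  forall (f : bimor (M b) (M a) (kob X) (kob Y)) Z,
    bfam (kproj Y) Z ∘ f Z = f Z.
Proof. by move=> hY f Z; rewrite hY comp1m. Qed.

Lemma full_compr b a (X Y : karoubi (bimcat (M b) (M a))) : full X ->
  forall (f : bimor (M b) (M a) (kob X) (kob Y)) Z,
    f Z ∘ bfam (kproj X) Z = f Z.
Proof. by move=> hX f Z; rewrite hX compm1. Qed.

Definition full_mor b a (X Y : karoubi (bimcat (M b) (M a)))
    (hX : full X) (hY : full Y) (f : bimor (M b) (M a) (kob X) (kob Y)) :
    mor X Y :=
  kbimor (full_compl hY f) (full_compr hX f).

Definition full_iso b a (X Y : karoubi (bimcat (M b) (M a)))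
    (hX : full X) (hY : full Y)
    (i : @iso (bimcat (M b) (M a)) (kob X) (kob Y)) : iso X Y.
Proof.
refine (@Iso _ X Y (full_mor hX hY (fwd i)) (full_mor hY hX (bwd i)) _ _);
  apply: kbimor_eq => Z.
- rewrite [RHS]hX.
  exact: (congr1 (fun f : bimor _ _ _ _ => f Z) (bwdK i)).
- rewrite [RHS]hY.
  exact: (congr1 (fun f : bimor _ _ _ _ => f Z) (fwdK i)).
Defined.

(** The multiplication is the identity, so being its section leaves no choice. Hence the unit at [A]
    is full for every splitting. *)
Lemma sec_id (t : splitting (idmonad A)) Z : sec t Z = idm Z.
Proof. by rewrite -(mu_sec t Z) comp1m. Qed.

Lemma full_unitA : full (unitarr s true).
Proof. by move=> Z; rewrite /= (sec_id (s true)) comp1m. Qed.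

Lemma full_kfull b a X : full (kfull b a X).
Proof. by []. Qed.

Lemma full_tens c b a X Y :
  full (@btens E c b a (kfull c b X) (kfull b a Y)).
Proof. by move=> Z; rewrite /= !emo_id comp1m. Qed.

Definition kembed_functor : functor A (HOM oA).
Proof.
refine (@Functor A (HOM oA) (fun X => kfull true true (lcanon X))
  (fun X Y f => @full_mor true true _ _ (@full_kfull true true (lcanon X))
    (@full_kfull true true (lcanon Y)) (embed_mor f)) _ _).
- by move=> X; apply: kbimor_eq => Z /=; rewrite tensm_id.
- by move=> X Y Z g f; apply: kbimor_eq => W /=; rewrite -tensm_comp comp1m.
Defined.

Definition kembed2 X Y :
    @iso (HOM oA) (tens (kembed_functor X) (kembed_functor Y))
      (kembed_functor (tens X Y)) :=
  @full_iso true true _ _ (@full_tens true true true (lcanon X) (lcanon Y))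
    (@full_kfull true true (lcanon (tens X Y))) (embed2 N X Y).

Definition kembed0 : @iso (HOM oA) tunit (kembed_functor tunit) :=
  @full_iso true true _ _ full_unitA (@full_kfull true true (lcanon tunit))
    (embed0 N).

Definition kembed : tensor_functor A (HOM oA).
Proof.
refine (@TensorFunctor A (HOM oA) kembed_functor kembed2 kembed0 _ _ _ _).
- move=> X X' Y Y' f g; apply: kbimor_eq => Z; apply: pack_inj => /=.
  rewrite id_comp_pack ?pack_tassocV // [RHS]comp_pack_id ?pack_tassocV //.
  by rewrite -tensm_comp comp1m compm1 tensmA.
- move=> X Y Z; apply: kbimor_eq => W; apply: pack_inj => /=.
  transitivity (pack (idm (X ⊗ (Y ⊗ (Z ⊗ W))))); last apply/esym;
    by do ?[apply: pack_id_compE|apply: pack_id_tens];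
    rewrite ?pack_tassocV ?pack_tassoc.
- move=> X; apply: kbimor_eq => W; apply: pack_inj => /=.
  rewrite ?(sec_id (s true)) ?tensm_id ?comp1m.
  by do ?[apply: pack_id_compE|apply: pack_id_tens];
    rewrite ?pack_tassocV ?pack_tlunitV ?pack_tlunit.
- move=> X; apply: kbimor_eq => W; apply: pack_inj => /=.
  rewrite ?(sec_id (s true)) ?tensm_id ?comp1m.
  by do ?[apply: pack_id_compE|apply: pack_id_tens];
    rewrite ?pack_tassocV ?pack_tlunitV ?pack_trunit.
Defined.

Lemma kembed_fully_faithful : fully_faithful kembed.
Proof.
move=> X Y; have [g gK Kg] := (embed_iso N).2 X Y.
exists (fun f => g (sval f)) => f; first exact: gK.
apply: (@kbimor_eq A bool M true true (kembed X) (kembed Y)) => Z.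
exact: (congr1 (fun h : bimor _ _ _ _ => h Z) (Kg (sval f))).
Qed.

(** The idempotent [p] itself serves both as inclusion of [(X, p)] into [(X, 1)] and as
    retraction. *)
Lemma kembed_retract (Y : HOM oA) : exists X : A, retract Y (kembed X).
Proof.
case: Y => -[S [X eX]] p pp; subst S; exists X.
pose K := KarOb pp; have pK Z : p Z ∘ p Z = p Z by exact: (kprojK K Z).
exists (@kbimor _ _ M true true K (kfull true true (lcanon X)) p
  (fun=> comp1m _) pK).
exists (@kbimor _ _ M true true (kfull true true (lcanon X)) K p
  pK (fun=> compm1 _)).
exact: kbimor_eq.
Qed.

Definition rho : @bhom E oB oA := kfull false true (lid A).
Definition rhob : @bhom E oA oB := kfull true false (lid A).

Local Notation L := (lcomp (lid A) (lcomp N (lid A))).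

(** With the unit at [B] viewed as the bimodule [N] and [rho ⊗ rhob] as [N N], this is the
    comultiplication [N -> N N], preceded by the projection [mu] of [N N] onto [N]. Dually
    [eta_bimor] is the multiplication followed by the inclusion [sec]. *)
Definition e_bimor : bimor N N (lid A)
  (lcomp (lid A) (lcomp (idmonad A) (lid A))).
Proof.
refine (@Bimor A N N (lid A) (lcomp (lid A) (lcomp (idmonad A) (lid A)))
  (fun Z => delta N Z ∘ mu N Z) _ _ _) => [|Z|Z] /=.
- exact: strong_comp (delta_strong N) (mu_strong N).
- by rewrite -compA muA emo_comp !compA frobl.
- by rewrite -compA -muA !compA frobr.
Defined.

Definition eta_bimor : bimor N N (lcomp (lid A) (lcomp (idmonad A) (lid A)))
  (lid A).
Proof.
refine (@Bimor A N N (lcomp (lid A) (lcomp (idmonad A) (lid A))) (lid A)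
  (fun Z => sec (s false) Z ∘ mu N Z) _ _ _) => [|Z|Z] /=.
- exact: strong_comp (sec_strong (s false)) (mu_strong N).
- by rewrite -compA muA emo_comp !compA (sec_modl (s false)).
- by rewrite -compA -muA !compA (sec_modr (s false)).
Defined.

Lemma full_rhobrho : full (@btens E oA oB oA rhob rho).
Proof. exact: full_tens. Qed.

Lemma full_rhobrho2 : full (@btens E oA oA oA (btens rhob rho) (btens rhob rho)).
Proof. by move=> Z; rewrite /= ?comp1m ?emo_id ?comp1m. Qed.

Definition eps_rho : mor (uarr (bunit oA)) (btens rhob rho) :=
  full_mor full_unitA full_rhobrho
    (@idbimor A (lid A) L (eta N) (@eta_strong _ N)).

Definition d_rho : mor (btens rhob rho) (uarr (bunit oA)) :=
  full_mor full_rhobrho full_unitA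
    (@idbimor A L (lid A) (counit N) (@counit_strong _ N)).

Definition e_rho : mor (uarr (bunit oB)) (btens rho rhob).
Proof.
refine (@kbimor A bool M false false (unitarr s false)
  (@btens E oB oA oB rho rhob) e_bimor _ _) => Z /=.
- by rewrite !emo_id !comp1m.
- by rewrite -!compA (compA (mu _ _)) (mu_sec (s false)) comp1m.
Defined.

Definition eta_rho : mor (btens rho rhob) (uarr (bunit oB)).
Proof.
refine (@kbimor A bool M false false (@btens E oB oA oB rho rhob)
  (unitarr s false) eta_bimor _ _) => Z /=.
- by rewrite -!compA (compA (mu _ _)) (mu_sec (s false)) comp1m.
- by rewrite !emo_id !compm1.
Defined.

Lemma rho_conjugation : conjugation_relations e_rho eps_rho d_rho eta_rho.
Proof.
split; apply: kbimor_eq => Z /=;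
  rewrite ?(sec_id (s true)) ?emo_id ?comp1m ?emo_id ?compm1.
(* In each zigzag the projection of the unit at [B] meets a constraint and cancels by [mu_sec]; a
   counit law of [delta] or a unit law of [mu] is left. *)
- by rewrite -!compA (mu_sec (s false)) compm1 delta_counitr.
- by rewrite -!compA (mu_sec (s false)) compm1 delta_counitl.
- by rewrite !compA (mu_sec (s false)) comp1m mu_etar.
- by rewrite !compA (mu_sec (s false)) comp1m mu_etal.
Qed.

(** The common form through which the two sides of the identity in (4) are compared: its components
    are exactly the structure maps of the monad. *)
Definition rho_frobdata : frobdata (HOM oA) :=
  @FrobData (HOM oA) (btens rhob rho) eps_rho d_rho
    (full_mor full_rhobrho full_rhobrho2
      (@idbimor A L (lcomp L (lcomp (idmonad A) L)) (delta N)
        (@delta_strong _ N)))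
    (full_mor full_rhobrho2 full_rhobrho
      (@idbimor A (lcomp L (lcomp (idmonad A) L)) L (mu N) (@mu_strong _ N))).

Lemma conjugation_frobdataE :
  conjugation_frobdata e_rho eps_rho d_rho eta_rho = rho_frobdata.
Proof.
congr FrobData; apply: kbimor_eq => Z /=;
  rewrite ?emo_id ?comp1m ?emo_id ?compm1 ?comp1m.
- by rewrite -compA (mu_sec (s false)) compm1.
- by rewrite compA (mu_sec (s false)) comp1m.
Qed.

Lemma rho_frobenius : is_frobenius rho_frobdata.
Proof.
split; [| |split|split|split]; apply: kbimor_eq => Z /=;
  rewrite ?(sec_id (s true)) ?emo_id ?comp1m ?emo_id ?compm1 ?comp1m.
- exact: deltaA.
- exact: muA.
- exact: delta_counitl.
- exact: delta_counitr.
- exact: mu_etal.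
- exact: mu_etar.
- exact: frobl.
- by rewrite frobr.
Qed.

Lemma full_karob_eq b a (X Y : @bhom E b a) : kob X = kob Y ->
  full X -> full Y -> X = Y.
Proof.
case: X Y => [X p pp] [Y q qq] /= e; subst Y => hX hY.
have e : p = q by apply: bimor_eq => Z; rewrite [LHS]hX [RHS]hY.
by subst q; congr KarOb; exact: Prop_irrelevance.
Qed.

(** The carriers are equal only propositionally, so the structure maps, whose types depend on them,
    are compared by [≈]. *)
Lemma full_frobdata_eq (F G : frobdata (HOM oA)) :
  kob (fr_ob F) = kob (fr_ob G) ->
  @full true true (fr_ob F) -> @full true true (fr_ob G) ->
  (forall Z, bfam (sval (fr_V F)) Z ≈ bfam (sval (fr_V G)) Z) ->
  (forall Z, bfam (sval (fr_V' F)) Z ≈ bfam (sval (fr_V' G)) Z) ->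
  (forall Z, bfam (sval (fr_W F)) Z ≈ bfam (sval (fr_W G)) Z) ->
  (forall Z, bfam (sval (fr_W' F)) Z ≈ bfam (sval (fr_W' G)) Z) ->
  F = G.
Proof.
case: F G => X V V' W W' [Y U U' T T'] e hX hY.
have eXY : X = Y :> HOM oA := @full_karob_eq true true X Y e hX hY.
move: U U' T T' {e hX hY}.
case: _ / eXY => U U' T T' eV eV' eW eW'.
have -> : V = U by apply: kbimor_eq => Z; exact: pack_inj (eV Z).
have -> : V' = U' by apply: kbimor_eq => Z; exact: pack_inj (eV' Z).
have -> : W = T by apply: kbimor_eq => Z; exact: pack_inj (eW Z).
by have -> : W' = T' by apply: kbimor_eq => Z; exact: pack_inj (eW' Z).
Qed.

End CompletedEmbedding.

(** * The image of the Frobenius algebra under the embedding *)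

Section FrobeniusImage.
Variables (A : strictcat) (F : frobenius A).
Variable s : forall b, splitting (abmonad (frobmon F) b).
Local Notation E := (@Bicat (completion (bimbicat (abmonad (frobmon F))))
  (completion_unit s)).

Lemma frob_image_kembed : frob_image (kembed s) F = rho_frobdata s.
Proof.
pose G := @FrobData (HOM (true : E)) (kembed s F)
  (fmap (kembed s) (fr_V F) ∘ tf0 (kembed s))
  (bwd (tf0 (kembed s)) ∘ fmap (kembed s) (fr_V' F))
  (bwd (tf2 (kembed s) F F) ∘ fmap (kembed s) (fr_W F))
  (fmap (kembed s) (fr_W' F) ∘ tf2 (kembed s) F F).
transitivity G; first by rewrite /G /frob_image; case: (frobd F).
apply: full_frobdata_eq => [||||||].
- exact: lfun_eq.
- exact: full_kfull.
- exact: full_rhobrho.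
- by move=> Z /=; rewrite comp_pack_id ?pack_tlunitV // pack_cast.
- by move=> Z /=; rewrite id_comp_pack ?pack_tlunit // pack_cast.
- by move=> Z /=; rewrite id_comp_pack ?pack_tassoc // pack_cast.
- by move=> Z /=; rewrite comp_pack_id ?pack_tassocV // pack_cast.
Qed.

End FrobeniusImage.

(** * Direct sums *)

Section Idempotents.
Variables (C : cat) (X : C) (p : mor X X).
Hypothesis pp : p ∘ p = p.

Lemma comp_idem Y (u : mor X Y) : u ∘ p ∘ p = u ∘ p.
Proof. by rewrite -compA pp. Qed.

Lemma idem_comp Y (u : mor Y X) : p ∘ (p ∘ u) = p ∘ u.
Proof. by rewrite compA pp. Qed.

Lemma idem_factor Y Z (u : mor X Y) (u' : mor Z X) :
  u ∘ p ∘ (p ∘ u') = u ∘ p ∘ u'.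
Proof. by rewrite compA comp_idem. Qed.

Lemma idem_retract Y (u : mor X Y) (u' : mor Y X) : u' ∘ u = idm X ->
  p ∘ u' ∘ (u ∘ p) = p.
Proof. by move=> uu; rewrite -compA (compA u') uu comp1m. Qed.

End Idempotents.

Section Whiskering.
Variable A : strictcat.

Definition whisker (M N : frobmonad A) (X Y : A) (f : mor X Y) :
    bimor M N (lcanon X) (lcanon Y) :=
  @free_bimor A M N (lcanon X) (lcanon Y) _ (strong_tens f).

Lemma whisker_comp (M : lfun A) (X Y Z : A) (g : mor Y Z) (f : mor X Y) W :
  emo M ((g ∘ f) ⊠ idm W) = emo M (g ⊠ idm W) ∘ emo M (f ⊠ idm W).
Proof. by rewrite -emo_comp -tensm_comp comp1m. Qed.

Lemma whisker_id (M : lfun A) W (X Y : A) (g : mor Y X) (f : mor X Y) :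
  g ∘ f = idm X ->
  emo M (g ⊠ idm W) ∘ emo M (f ⊠ idm W) = idm (M (tens X W)).
Proof. by rewrite -whisker_comp => ->; rewrite tensm_id emo_id. Qed.

End Whiskering.

Section Additivity.
Variables (R : realType) (A : tensor_cstar R).
Local Open Scope ring_scope.
Local Notation sA := (strictcat_of A).
Local Notation lin := (@lin R A).
Local Notation mor0 := (@mor0 R A).

Lemma lin0l (X Y : sA) (f : mor X Y) : lin 1 (mor0 X Y) f = f.
Proof. by rewrite /lin /mor0 scaler0 add0r. Qed.

Lemma lin0r (X Y : sA) (f : mor X Y) : lin 1 f (mor0 X Y) = f.
Proof. by rewrite /lin /mor0 scale1r addr0. Qed.

(** The idempotent splitting off the direct sum of the images of [p] and [q]. *)
Lemma biproduct_idempotent (X Y Z : sA) (u : mor X Z) (u' : mor Z X)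
    (v : mor Y Z) (v' : mor Z Y) (p : mor X X) (q : mor Y Y) :
  u' ∘ u = idm X -> v' ∘ v = idm Y -> u' ∘ v = mor0 Y X -> v' ∘ u = mor0 X Y ->
  p ∘ p = p -> q ∘ q = q ->
  let r := lin 1 (u ∘ p ∘ u') (v ∘ q ∘ v') in
  [/\ r ∘ r = r, r ∘ (u ∘ p) = u ∘ p, (p ∘ u') ∘ r = p ∘ u',
      r ∘ (v ∘ q) = v ∘ q & (q ∘ v') ∘ r = q ∘ v'].
Proof.
move=> uu vv uv vu pp qq r.
have ru : r ∘ (u ∘ p) = u ∘ p.
  rewrite lin_compl -!compA (compA u') uu comp1m pp (compA v') vu.
  by rewrite mor0_compl !mor0_compr lin0r.
have rv : r ∘ (v ∘ q) = v ∘ q.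
  rewrite lin_compl -!compA (compA v') vv comp1m qq (compA u') uv.
  by rewrite mor0_compl !mor0_compr lin0l.
have ur : (p ∘ u') ∘ r = p ∘ u'.
  rewrite lin_compr !compA -(compA p u' u) uu compm1 pp -(compA p u' v) uv.
  by rewrite mor0_compr !mor0_compl lin0r.
have vr : (q ∘ v') ∘ r = q ∘ v'.
  rewrite lin_compr !compA -(compA q v' v) vv compm1 qq -(compA q v' u) vu.
  by rewrite mor0_compr !mor0_compl lin0l.
split=> //; rewrite {2}/r lin_compr (compA r) ru (compA r) rv.
by rewrite -/r.
Qed.

Lemma lin_fixl k (X Y : sA) (p : mor Y Y) (f g : mor X Y) :
  p ∘ f = f -> p ∘ g = g -> p ∘ lin k f g = lin k f g.
Proof. by move=> ef eg; rewrite lin_compr ef eg. Qed.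

Lemma lin_fixr k (X Y : sA) (p : mor X X) (f g : mor X Y) :
  f ∘ p = f -> g ∘ p = g -> lin k f g ∘ p = lin k f g.
Proof. by move=> ef eg; rewrite lin_compl ef eg. Qed.

Lemma direct_sum_biproduct (X Y : sA) : closed_under_direct_sums A ->
  exists (Z : sA) (U : mor X Z) (U' : mor Z X) (V : mor Y Z) (V' : mor Z Y),
    [/\ U' ∘ U = idm X, V' ∘ V = idm Y, U' ∘ V = mor0 Y X, V' ∘ U = mor0 X Y &
        lin 1 (U ∘ U') (V ∘ V') = idm Z].
Proof.
move=> /(_ X Y)[Z [U [V [UU VV UV]]]]; exists Z, U, (star U), V, (star V).
have {}UV : lin 1 (U ∘ star U) (V ∘ star V) = idm Z by rewrite /lin scale1r.
(* Inserting the decomposition of the identity between [star U] and [V] yields [star U ∘ V] twice,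
   so it vanishes. *)
have UV0 : star U ∘ V = mor0 Y X.
  have : star U ∘ lin 1 (U ∘ star U) (V ∘ star V) ∘ V = star U ∘ V.
    by rewrite UV compm1.
  rewrite lin_compr lin_compl -!compA VV !compA UU compm1 comp1m /lin scale1r.
  by move=> e; apply: (@addIr (shom Y X) (star U ∘ V)); rewrite add0r.
split=> //; rewrite -[LHS](@star_invol R A) star_comp star_invol UV0.
by have := @starB R A Y X 0 0; rewrite subr0 subrr.
Qed.

Lemma whisker_0 (M : lfun sA) W (X Y Z : sA) (g : mor Y Z) (f : mor X Y) :
  g ∘ f = mor0 X Z ->
  emo M (g ⊠ idm W) ∘ emo M (f ⊠ idm W) = mor0 (M (tens X W)) (M (tens Z W)).
Proof. by rewrite -whisker_comp => ->; rewrite mor0_tensl emo_mor0. Qed.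

Lemma emo_lin_compr (S T : lfun sA) k (X Y : sA) (Z : sA)
    (h : mor (S (T Y)) Z) (f g : mor X Y) :
  h ∘ emo S (emo T (lin k f g))
  = lin k (h ∘ emo S (emo T f)) (h ∘ emo S (emo T g)).
Proof. by rewrite !emo_lin lin_compr. Qed.

Section Completion.
Variables (K : Type) (M : K -> frobmonad sA) (s : forall b, splitting (M b)).
Local Notation E := (@Bicat (completion (bimbicat M)) (completion_unit s)).

Section Morphisms.
Variables (b a : K) (X Y : karoubi (bimcat (M b) (M a))).

Definition klin (k : R[i]) (f g : mor X Y) : mor X Y.
Proof.
refine (@kbimor _ _ M b a X Y (linb k (sval f) (sval g)) _ _) => Z /=.
- exact: (@lin_fixl k _ _ (bfam (kproj Y) Z) (bfam (sval f) Z) (bfam (sval g) Z)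
    (kbimorPl f Z) (kbimorPl g Z)).
- exact: (@lin_fixr k _ _ (bfam (kproj X) Z) (bfam (sval f) Z) (bfam (sval g) Z)
    (kbimorPr f Z) (kbimorPr g Z)).
Defined.

Definition kmor0 : mor X Y.
Proof.
refine (@kbimor _ _ M b a X Y (bimor0 _ _ _ _) _ _) => Z /=.
- by rewrite mor0_compr.
- by rewrite mor0_compl.
Defined.

Definition kmor_zmodType : zmodType :=
  @pullback_zmodType R[i] sA
    (fun Z => shom (M b (kob X (M a Z))) (M b (kob Y (M a Z)))) (mor X Y)
    (fun f => bfam (sval f)) klin kmor0 (@kbimor_eq _ _ M b a X Y)
    (fun=> fun=> fun=> fun=> erefl) (fun=> erefl).

Lemma kmor_addE (f g : kmor_zmodType) : f + g = klin 1 f g.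
Proof. by []. Qed.

End Morphisms.

Lemma klin_compl b a (X Y Z : @bhom E b a) k (h h' : mor Y Z) (f : mor X Y) :
  klin k h h' ∘ f = klin k (h ∘ f) (h' ∘ f).
Proof.
refine (@kbimor_eq sA K M b a X Z _ _ _) => W.
refine (lin_compl k _ _ _).
Qed.

Lemma klin_compr b a (X Y Z : @bhom E b a) k (h : mor Y Z) (f f' : mor X Y) :
  h ∘ klin k f f' = klin k (h ∘ f) (h ∘ f').
Proof.
refine (@kbimor_eq sA K M b a X Z _ _ _) => W.
refine (lin_compr k _ _ _).
Qed.

Lemma klin_tensl c b a (X X' : @bhom E c b) (Y Y' : @bhom E b a) k
    (f f' : mor X X') (g : mor Y Y') :
  @btensm E c b a _ _ _ _ (klin k f f') g
  = klin k (@btensm E c b a _ _ _ _ f g) (@btensm E c b a _ _ _ _ f' g).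
Proof.
refine (@kbimor_eq sA K M c a (@btens E c b a X Y) (@btens E c b a X' Y')
  _ _ _) => W.
refine (lin_compl k _ _ _).
Qed.

Lemma klin_tensr c b a (X X' : @bhom E c b) (Y Y' : @bhom E b a) k
    (f : mor X X') (g g' : mor Y Y') :
  @btensm E c b a _ _ _ _ f (klin k g g')
  = klin k (@btensm E c b a _ _ _ _ f g) (@btensm E c b a _ _ _ _ f g').
Proof.
refine (@kbimor_eq sA K M c a (@btens E c b a X Y) (@btens E c b a X' Y')
  _ _ _) => W.
refine (@emo_lin_compr (M c) (kob X) k _ _ _ _ _ _).
Qed.

Definition completion_preadditive : preadditive E.
Proof.
refine (@Preadditive E
  (fun b a X Y => GRing.Zmodule.class (@kmor_zmodType b a X Y)) _ _ _ _).
- move=> b a X Y Z h h' f; cbv zeta.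
  rewrite !kmor_addE; exact: klin_compl.
- move=> b a X Y Z h f f'; cbv zeta.
  rewrite !kmor_addE; exact: klin_compr.
- move=> c b a X X' Y Y' f f' g; cbv zeta.
  rewrite !kmor_addE; exact: klin_tensl.
- move=> c b a X X' Y Y' f g g'; cbv zeta.
  rewrite !kmor_addE; exact: klin_tensr.
Defined.

Lemma has_direct_sums : closed_under_direct_sums A ->
  has_direct_sums2 completion_preadditive.
Proof.
move=> Asum b a [[S [x eS]] p pp] [[T [y eT]] q qq]; subst S T.
have [z [U [U' [V [V' [UU VV UV VU UUVV]]]]]] :=
  @direct_sum_biproduct x y Asum.
have pK W : p W ∘ p W = p W by exact: (kprojK (KarOb pp) W).
have qK W : q W ∘ q W = q W by exact: (kprojK (KarOb qq) W).
pose wh X Y (f : mor X Y) : bimor (M b) (M a) (lcanon X) (lcanon Y) :=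
  whisker (M b) (M a) f.
(* The direct sum [z] of the underlying objects carries [U p U' + V q V'], which cuts out the images
   of [p] and [q]. The maps exhibiting the sum are [U p], [p U'], [V q] and [q V'], all whiskered by
   the outer monads. *)
pose r := linb 1 (bimor_comp (bimor_comp (wh _ _ U) p) (wh _ _ U'))
  (bimor_comp (bimor_comp (wh _ _ V) q) (wh _ _ V')).
have [rr rU Ur rV Vr] : [/\ forall W, r W ∘ r W = r W,
    forall W, r W ∘ (wh _ _ U W ∘ p W) = wh _ _ U W ∘ p W,
    forall W, p W ∘ wh _ _ U' W ∘ r W = p W ∘ wh _ _ U' W,
    forall W, r W ∘ (wh _ _ V W ∘ q W) = wh _ _ V W ∘ q W &
    forall W, q W ∘ wh _ _ V' W ∘ r W = q W ∘ wh _ _ V' W].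
  have rW W := biproduct_idempotent (whisker_id (M b) (M a W) UU)
    (whisker_id (M b) (M a W) VV) (whisker_0 (M b) (M a W) UV)
    (whisker_0 (M b) (M a W) VU) (pK W) (qK W).
  by split=> W; case: (rW W).
have rP : r = bimor_comp r r by apply: bimor_eq => W; rewrite /= rr.
pose Z : karoubi (bimcat (M b) (M a)) := @KarOb (bimcat (M b) (M a)) _ r rP.
pose X' : karoubi (bimcat (M b) (M a)) := KarOb pp.
pose Y' : karoubi (bimcat (M b) (M a)) := KarOb qq.
exists Z.
exists (@kbimor _ _ M b a X' Z (bimor_comp (wh _ _ U) p) rU
  (fun W => comp_idem (pK W) (wh _ _ U W))).
exists (@kbimor _ _ M b a Z X' (bimor_comp p (wh _ _ U'))
  (fun W => idem_comp (pK W) (wh _ _ U' W)) Ur).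
exists (@kbimor _ _ M b a Y' Z (bimor_comp (wh _ _ V) q) rV
  (fun W => comp_idem (qK W) (wh _ _ V W))).
exists (@kbimor _ _ M b a Z Y' (bimor_comp q (wh _ _ V'))
  (fun W => idem_comp (qK W) (wh _ _ V' W)) Vr).
split; apply: kbimor_eq => W.
- refine (@idem_retract sA _ (p W) (pK W) _ (wh _ _ U W) (wh _ _ U' W) _).
  exact: (whisker_id (M b) (M a W) UU).
- refine (@idem_retract sA _ (q W) (qK W) _ (wh _ _ V W) (wh _ _ V' W) _).
  exact: (whisker_id (M b) (M a W) VV).
- congr (lin 1 _ _).
  + refine (@idem_factor sA _ (p W) (pK W) _ _ (wh _ _ U W) (wh _ _ U' W)).
  + refine (@idem_factor sA _ (q W) (qK W) _ _ (wh _ _ V W) (wh _ _ V' W)).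
Qed.

End Completion.
End Additivity.

Lemma conj_comp (C : cat) (X Y Y' Z V W : C) (u : mor Z W) (g : mor Y Z)
    (f : mor X Y) (w : mor V X) (a : mor Y' Y) (b : mor Y Y') :
  a ∘ b = idm Y -> u ∘ (g ∘ f) ∘ w = (u ∘ g ∘ a) ∘ (b ∘ f ∘ w).
Proof. by move=> ab; rewrite -!compA (compA a) ab comp1m. Qed.

Lemma conj_cancel (C : cat) (X X' Y Y' : C) (f : mor X Y) (a : mor X' X)
    (b : mor X X') (c : mor Y' Y) (d : mor Y Y') :
  c ∘ d = idm Y -> a ∘ b = idm X -> c ∘ (d ∘ f ∘ a) ∘ b = f.
Proof. by move=> cd ab; rewrite -!compA ab compm1 compA cd comp1m. Qed.

(** * Invariance under isomorphism *)

Section MonadIsomorphisms.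
Variable A : strictcat.
Implicit Types (X Y S T : lfun A) (Z W : A).

(** Bimodule transformations are defined through the multiplications, so [mi_mu] is the law that
    lets them be carried from [M] to [M']. *)
Record monad_iso (M M' : frobmonad A) := MonadIso {
  mi : forall Z, mor (M Z) (M' Z);
  miV : forall Z, mor (M' Z) (M Z);
  mi_strong : strong mi;
  miV_strong : strong miV;
  miK : forall Z, miV Z ∘ mi Z = idm (M Z);
  miVK : forall Z, mi Z ∘ miV Z = idm (M' Z);
  mi_mu : forall Z, mi Z ∘ mu M Z = mu M' Z ∘ (mi (M' Z) ∘ emo M (mi Z)) }.

Lemma mi_nat M M' (t : monad_iso M M') Z W (f : mor Z W) :
  mi t W ∘ emo M f = emo M' f ∘ mi t Z.
Proof. exact: strong_nat (mi_strong t). Qed.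

Lemma miV_nat M M' (t : monad_iso M M') Z W (f : mor Z W) :
  miV t W ∘ emo M' f = emo M f ∘ miV t Z.
Proof. exact: strong_nat (miV_strong t). Qed.

Lemma miV_mu M M' (t : monad_iso M M') Z :
  miV t Z ∘ mu M' Z = mu M Z ∘ (miV t (M Z) ∘ emo M' (miV t Z)).
Proof.
rewrite -[RHS]comp1m -(miK t) -compA (compA _ (mu M Z)) mi_mu -!compA.
rewrite (compA _ (miV t (M Z))) -miV_nat -!compA -emo_comp miVK emo_id compm1.
by rewrite miVK compm1.
Qed.

Definition monad_iso_sym M M' (t : monad_iso M M') : monad_iso M' M :=
  MonadIso (miV_strong t) (mi_strong t) (miVK t) (miK t) (miV_mu t).

Section Transport.
Variables (M N M' N' : frobmonad A).
Variables (t : monad_iso M M') (r : monad_iso N N').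

Definition sandwich X Z : mor (M (X (N Z))) (M' (X (N' Z))) :=
  mi t (X (N' Z)) ∘ emo M (emo X (mi r Z)).

Definition sandwichV X Z : mor (M' (X (N' Z))) (M (X (N Z))) :=
  emo M (emo X (miV r Z)) ∘ miV t (X (N' Z)).

Lemma sandwichK X Z : sandwichV X Z ∘ sandwich X Z = idm _.
Proof.
rewrite /sandwich /sandwichV -compA (compA (miV _ _)) miK comp1m -!emo_comp.
by rewrite miK !emo_id.
Qed.

Lemma sandwichVK X Z : sandwich X Z ∘ sandwichV X Z = idm _.
Proof.
rewrite /sandwich /sandwichV -compA (compA (emo _ _)) -!emo_comp miVK !emo_id.
by rewrite comp1m miVK.
Qed.

(** The isomorphism of free bimodules is semilinear along [t]; this and its right-hand and inverse
    versions make conjugates of bimodule transformations linear over the new monads. *)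
Lemma sandwich_mul X Z : sandwich X Z ∘ mu M (X (N Z))
  = mu M' (X (N' Z)) ∘ (mi t (M' (X (N' Z))) ∘ emo M (sandwich X Z)).
Proof.
by rewrite /sandwich -compA -mu_nat compA mi_mu emo_comp !compA.
Qed.

Lemma sandwich_mur X Z : sandwich X Z ∘ emo M (emo X (mu N Z))
  = emo M' (emo X (mu N' Z)) ∘ (sandwich X (N' Z)
      ∘ emo M (emo X (emo N (mi r Z)))).
Proof.
rewrite /sandwich -compA -!emo_comp mi_mu !emo_comp !compA; congr comp.
by rewrite -mi_nat.
Qed.

Lemma sandwichV_mul X Z : sandwichV X Z ∘ mu M' (X (N' Z))
  = mu M (X (N Z)) ∘ (emo M (sandwichV X Z) ∘ miV t (M' (X (N' Z)))).
Proof.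
rewrite /sandwichV -compA miV_mu miV_nat emo_comp !compA; congr (_ ∘ _ ∘ _).
by rewrite mu_nat.
Qed.

Lemma sandwichV_mur X Z : sandwichV X Z ∘ emo M' (emo X (mu N' Z))
  = emo M (emo X (mu N Z)) ∘ (emo M (emo X (emo N (miV r Z)))
      ∘ sandwichV X (N' Z)).
Proof.
rewrite /sandwichV -compA miV_nat !compA -!emo_comp.
congr (emo M (emo X _) ∘ _).
by rewrite miV_mu miV_nat compA.
Qed.

Lemma sandwich_strong X :
  strong (S := ecomp M (ecomp X N)) (T := ecomp M' (ecomp X N')) (sandwich X).
Proof.
apply: (strong_comp (T := ecomp M (ecomp X N'))).
- exact: (strong_whiskerr (lcomp X N') (mi_strong t)).
- exact: (strong_whiskerl (lcomp M X) (mi_strong r)).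
Qed.

Lemma sandwichV_strong X :
  strong (S := ecomp M' (ecomp X N')) (T := ecomp M (ecomp X N)) (sandwichV X).
Proof.
apply: (strong_comp (T := ecomp M (ecomp X N'))).
- exact: (strong_whiskerl (lcomp M X) (miV_strong r)).
- exact: (strong_whiskerr (lcomp X N') (miV_strong t)).
Qed.

Definition transport X Y (f : bimor M N X Y) : bimor M' N' X Y.
Proof.
refine (@Bimor A M' N' X Y
  (fun Z => sandwich Y Z ∘ f Z ∘ sandwichV X Z) _ _ _) => [|Z|Z].
- apply: (strong_comp (T := ecomp M (ecomp X N))) (sandwichV_strong X).
  exact: (strong_comp (T := ecomp M (ecomp Y N))) (sandwich_strong Y)
    (bfam_strong f).
- rewrite -compA sandwichV_mul compA -(compA (sandwich Y Z)) bfam_modl.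
  rewrite (compA (sandwich Y Z)) sandwich_mul -!compA; congr comp.
  rewrite (compA (emo M (bfam f Z))) (compA (emo M (sandwich Y Z))) -!emo_comp.
  by rewrite compA mi_nat -(compA (emo M' _)) miVK compm1 /sandwich !compA.
- rewrite -(compA _ (sandwichV X Z)) sandwichV_mur.
  move: (sandwich_mur Y Z) (sandwichV X (N' Z)).
  move: (sandwich Y Z) (sandwich Y (N' Z)) => u v e w.
  rewrite !compA -(compA u) bfam_modr (compA u) e -!compA.
  congr comp; congr comp; rewrite (compA (bfam f (N Z))) bimor_nat -compA.
  by rewrite compA -!emo_comp miVK !emo_id comp1m.
Defined.

Definition transport_functor : functor (bimcat M N) (bimcat M' N').
Proof.
refine (@Functor (bimcat M N) (bimcat M' N') id transport _ _).
- by move=> X; apply: bimor_eq => Z /=; rewrite compm1 sandwichVK.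
- move=> X Y S g f; apply: bimor_eq => Z /=.
  exact: conj_comp (sandwichK Y Z).
Defined.

End Transport.

Lemma sandwich_sym M N M' N' (t : monad_iso M M') (r : monad_iso N N') X Z :
  sandwich (monad_iso_sym t) (monad_iso_sym r) X Z = sandwichV t r X Z.
Proof. exact: miV_nat. Qed.

Lemma sandwichV_sym M N M' N' (t : monad_iso M M') (r : monad_iso N N') X Z :
  sandwichV (monad_iso_sym t) (monad_iso_sym r) X Z = sandwich t r X Z.
Proof. by rewrite /sandwich mi_nat. Qed.

Lemma transportK M N M' N' (t : monad_iso M M') (r : monad_iso N N') X Y :
  cancel (@transport M N M' N' t r X Y)
    (@transport M' N' M N (monad_iso_sym t) (monad_iso_sym r) X Y).
Proof.
move=> f; apply: bimor_eq => Z; rewrite /= sandwich_sym sandwichV_sym.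
exact: conj_cancel (sandwichK t r Y Z) (sandwichK t r X Z).
Qed.

Lemma transport_iso M N M' N' (t : monad_iso M M') (r : monad_iso N N') :
  functor_iso (transport_functor t r).
Proof.
split=> [|X Y]; first by exists id.
exists (@transport M' N' M N (monad_iso_sym t) (monad_iso_sym r) X Y).
  exact: transportK.
move=> f; rewrite -[RHS](transportK (monad_iso_sym t) (monad_iso_sym r)).
exact: bimor_eq.
Qed.

End MonadIsomorphisms.

(** * Isomorphic monads give isomorphic almost-2-categories *)

Section TransportBicategory.
Variables (A : strictcat) (K : Type) (M M' : K -> frobmonad A).
Variable t : forall b, monad_iso (M b) (M' b).
Implicit Types (X Y S T : lfun A) (Z W : A) (a b c d : K).

(** Transport fixes 1-arrows, but their composite through [b] contains [M b] on one side and [M' b]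
    on the other. The inverse of [t b] on this middle factor is the coherence isomorphism, so
    composition is preserved up to isomorphism. *)
Definition middle c b a X Y : @iso (bimcat (M' c) (M' a))
  (lcomp X (lcomp (M' b) Y)) (lcomp X (lcomp (M b) Y)).
Proof.
refine (@Iso (bimcat (M' c) (M' a)) (lcomp X (lcomp (M' b) Y))
  (lcomp X (lcomp (M b) Y))
  (@free_bimor A (M' c) (M' a) (lcomp X (lcomp (M' b) Y)) (lcomp X (lcomp (M b) Y))
    (fun Z => emo X (miV (t b) (Y Z)))
    (strong_whiskerl X (strong_whiskerr Y (miV_strong (t b)))))
  (@free_bimor A (M' c) (M' a) (lcomp X (lcomp (M b) Y)) (lcomp X (lcomp (M' b) Y))
    (fun Z => emo X (mi (t b) (Y Z)))
    (strong_whiskerl X (strong_whiskerr Y (mi_strong (t b)))))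
  _ _); apply: bimor_eq => Z /=.
- by rewrite -!emo_comp miVK !emo_id.
- by rewrite -!emo_comp miK !emo_id.
Defined.

Lemma middle_natE c b a X X' Y Y' (f : bimor (M c) (M b) X X')
    (g : bimor (M b) (M a) Y Y') Z :
  emo (M' c) (emo X' (miV (t b) (Y' (M' a Z))))
    ∘ (transport (t c) (t b) f (Y' (M' a Z))
       ∘ emo (M' c) (emo X (transport (t b) (t a) g Z)))
  = transport (t c) (t a) (bimor_tens f g) Z
    ∘ emo (M' c) (emo X (miV (t b) (Y (M' a Z)))).
Proof.
rewrite /= /sandwich /sandwichV /=.
rewrite -!compA (compA (emo (M' c) _) (mi _ _)) -mi_nat -!compA; congr comp.
rewrite (compA (emo _ _) (emo _ _)) -!emo_comp miK !emo_id comp1m.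
rewrite !miV_nat.
rewrite (compA (emo (M c) (emo X' _)) (bfam f _)).
rewrite -(strong_nat (S := lcomp (M c) (lcomp X (M b)))
  (T := lcomp (M c) (lcomp X' (M b))) _ (bfam_strong f)) -!compA; congr comp.
rewrite /= !compA -!emo_comp; congr (emo _ (emo _ _) ∘ _).
by rewrite !compA miK comp1m.
Qed.

Lemma middle_assocE d c b a X Y S Z :
  transport (t d) (t a) (fwd (@bimassoc A K M d c b a X Y S)) Z
    ∘ emo (M' d) (emo X (emo (M c) (emo Y (miV (t b) (S (M' a Z))))))
    ∘ emo (M' d) (emo X (miV (t c) (Y (M' b (S (M' a Z))))))
  = emo (M' d) (emo X (miV (t c) (Y (M b (S (M' a Z))))))
    ∘ emo (M' d) (emo X (emo (M' c) (emo Y (miV (t b) (S (M' a Z)))))).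
Proof.
rewrite /= compm1.
(* The associator has identity components, so its transport is [sandwich ∘ sandwichV]; the two
   bracketings agree by conversion, and [sandwichVK] applies. *)
have -> : sandwich (t d) (t a) (lcomp X (lcomp (M c) (lcomp Y (lcomp (M b) S)))) Z
    ∘ sandwichV (t d) (t a) (lcomp (lcomp X (lcomp (M c) Y)) (lcomp (M b) S)) Z
    = idm _.
  exact: (sandwichVK (t d) (t a)
    (lcomp X (lcomp (M c) (lcomp Y (lcomp (M b) S)))) Z).
by rewrite comp1m -!emo_comp miV_nat.
Qed.

Definition transport_semipseudo : semipseudo (bimbicat M) (bimbicat M').
Proof.
refine (@SemiPseudo (bimbicat M) (bimbicat M') id
  (fun b a => transport_functor (t b) (t a)) middle _ _).
- move=> c b a X X' Y Y' f g; apply: bimor_eq => Z; exact: middle_natE.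
- move=> d c b a X Y Z; apply: bimor_eq => W.
  have := @middle_assocE d c b a X Y Z W.
  rewrite /= !emo_id !compm1 comp1m => ->; exact: erefl.
Defined.

Lemma transport_semipseudo_iso : semipseudo_iso transport_semipseudo.
Proof. by split; [exists id | move=> b a; exact: transport_iso]. Qed.

End TransportBicategory.

(** * Functoriality of the completion under projections *)

Section KaroubiFunctor.
Variables (C D : cat) (F : functor C D).

Lemma fmap_kprojP (X : karob C) :
  fmap F (kproj X) = fmap F (kproj X) ∘ fmap F (kproj X).
Proof. by rewrite -fmap_comp -kprojP. Qed.

Definition kar_ob (X : karob C) : karob D := KarOb (fmap_kprojP X).

Lemma kar_mapl (X Y : karob C) (f : karhom X Y) :
  kproj (kar_ob Y) ∘ fmap F (sval f) = fmap F (sval f).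
Proof. by rewrite /= -fmap_comp karhomPl. Qed.

Lemma kar_mapr (X Y : karob C) (f : karhom X Y) :
  fmap F (sval f) ∘ kproj (kar_ob X) = fmap F (sval f).
Proof. by rewrite /= -fmap_comp karhomPr. Qed.

Definition kar_functor : functor (karoubi C) (karoubi D).
Proof.
refine (@Functor (karoubi C) (karoubi D) kar_ob
  (fun X Y f => @karhom_fix D (kar_ob X) (kar_ob Y) (fmap F (sval f))
    (kar_mapl f) (kar_mapr f)) _ _).
- by move=> X; apply: karhom_eq.
- by move=> X Y Z g f; apply: karhom_eq; rewrite /= fmap_comp.
Defined.

Lemma surj_inj_bijective (S T : Type) (f : S -> T) :
  injective f -> (forall y, exists x, f x = y) -> bijective f.
Proof.
move=> finj /choice[g gK]; exists g => // x.
exact: finj (gK (f x)).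
Qed.

(** Injectivity and surjectivity are treated separately, so that equalities of objects can be
    substituted instead of transporting idempotents along a chosen inverse. *)
Lemma kar_functor_iso : functor_iso F -> functor_iso kar_functor.
Proof.
case=> Fob Fmor.
have Finj X Y := bij_inj (Fmor X Y).
have Fsurj X Y (g : mor (F X) (F Y)) : exists f, fmap F f = g.
  by have [h _ hK] := Fmor X Y; exists (h g).
split.
  apply: surj_inj_bijective => [[X p pp] [Y q qq] e|[Y q qq]].
    have eXY : X = Y by apply: (bij_inj Fob); exact: (congr1 (@kob _) e).
    subst Y; have epq : p = q.
      apply: Finj; pose pr (Z : karob D) := existT (fun Z => mor Z Z) _ (kproj Z).
      exact: existT_inj (congr1 pr e).
    by subst q; congr KarOb; exact: Prop_irrelevance.
  have [G _ GK] := Fob; have [X eX] : exists X, fob F X = Y by exists (G Y).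
  subst Y; have [p ep] := Fsurj _ _ q; subst q.
  have pp : p = p ∘ p by apply: Finj; rewrite fmap_comp.
  exists (KarOb pp); rewrite /= /kar_ob /=; congr KarOb.
  exact: Prop_irrelevance.
move=> X Y; apply: surj_inj_bijective => [f g e|g].
  by apply: karhom_eq; apply: Finj; exact: (congr1 sval e).
have [f ef] := Fsurj _ _ (sval g).
have fl : kproj Y ∘ f = f.
  by apply: Finj; rewrite fmap_comp ef; exact: (karhomPl g).
have fr : f ∘ kproj X = f.
  by apply: Finj; rewrite fmap_comp ef; exact: (karhomPr g).
by exists (karhom_fix fl fr); apply: karhom_eq.
Qed.

End KaroubiFunctor.

(** A commuting diagram still commutes after idempotents are inserted at its vertices: by naturality
    they all slide to the last vertex, where they merge into [q]. *)
Lemma projected_square (C : cat) (T0 T1 T2 T3 T4 T5 : C)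
    (u : mor T0 T4) (g1 : mor T4 T4) (f1 : mor T4 T5) (s : mor T5 T5)
    (h : mor T5 T3) (q : mor T3 T3)
    (a : mor T0 T1) (g3 : mor T1 T1) (v : mor T1 T2) (g2 : mor T2 T2)
    (f2 : mor T2 T3) :
  f1 ∘ g1 = s ∘ f1 -> f2 ∘ g2 = q ∘ f2 -> v ∘ g3 = g2 ∘ v -> h ∘ s = q ∘ h ->
  q ∘ q = q -> s ∘ s = s -> g2 ∘ g2 = g2 -> h ∘ f1 ∘ u = f2 ∘ v ∘ a ->
  q ∘ h ∘ (s ∘ f1) ∘ (g1 ∘ u) = q ∘ f2 ∘ (g2 ∘ v) ∘ (g3 ∘ a).
Proof.
move=> n1 n2 n3 n4 qq ss gg e.
rewrite -!compA (compA f1 g1) n1 -!compA (compA s s) ss (compA h s) n4 -!compA.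
rewrite (compA q q) qq (compA v g3) n3 -!compA (compA g2 g2) gg (compA f2 g2) n2.
by rewrite -!compA (compA q q) qq; congr comp; rewrite !compA.
Qed.

Section CompletionPseudo.
Local Open Scope bicat_scope.
Variables (E F : semibicat) (P : semipseudo E F).

Section Tensor.
Variables (c b a : E) (X : karob (bhom (s := E) c b)) (Y : karob (bhom b a)).
Let PX := kar_ob (psfun P c b) X.
Let PY := kar_ob (psfun P b a) Y.
Let P1 := kproj (ktens PX PY).
Let P2 := kproj (kar_ob (psfun P c a) (ktens X Y)).
Let phi := ps2 P (kob X) (kob Y).

Let P1P : P1 ∘ P1 = P1.
Proof. exact: esym (kprojP _). Qed.

Let P2P : P2 ∘ P2 = P2.
Proof. exact: esym (kprojP _). Qed.

Let phiP : phi ∘ P1 = P2 ∘ phi.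
Proof. exact: ps2_nat. Qed.

Let phiVP : P1 ∘ bwd phi = bwd phi ∘ P2.
Proof.
by rewrite -[LHS]comp1m -(bwdK phi) compA -(compA (bwd phi)) phiP -!compA fwdK
  compm1.
Qed.

Lemma kar2_l : P2 ∘ (P2 ∘ phi) = P2 ∘ phi.
Proof. by rewrite compA P2P. Qed.

Lemma kar2_r : P2 ∘ phi ∘ P1 = P2 ∘ phi.
Proof. by rewrite -compA phiP compA P2P. Qed.

Lemma kar2V_l : P1 ∘ (P1 ∘ bwd phi) = P1 ∘ bwd phi.
Proof. by rewrite compA P1P. Qed.

Lemma kar2V_r : P1 ∘ bwd phi ∘ P2 = P1 ∘ bwd phi.
Proof. by rewrite -compA -phiVP compA P1P. Qed.

Definition kar2 : @iso (karoubi _) (ktens PX PY)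
  (kar_ob (psfun P c a) (ktens X Y)).
Proof.
refine (@Iso (karoubi _) (ktens PX PY) (kar_ob (psfun P c a) (ktens X Y))
  (@karhom_fix _ (ktens PX PY) (kar_ob (psfun P c a) (ktens X Y)) (P2 ∘ phi)
    kar2_l kar2_r)
  (@karhom_fix _ (kar_ob (psfun P c a) (ktens X Y)) (ktens PX PY)
    (P1 ∘ bwd phi) kar2V_l kar2V_r) _ _).
- apply: karhom_eq; rewrite /= -/P1 -/P2 phiVP -compA (compA P2) P2P.
  by rewrite -phiP compA bwdK comp1m.
- apply: karhom_eq; rewrite /= -/P1 -/P2 -phiP -compA (compA P1) P1P.
  by rewrite phiVP compA fwdK comp1m.
Defined.

End Tensor.

Lemma kar2_assoc (d c b a : E) (X : karob (bhom d c)) (Y : karob (bhom c b))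
    (Z : karob (bhom b a)) (p := kproj X) (q := kproj Y) (r := kproj Z) :
  fmap (psfun P d a) ((p ⊠ q ⊠ r) ∘ bassoc (kob X) (kob Y) (kob Z))
    ∘ (fmap (psfun P d a) ((p ⊠ q) ⊠ r) ∘ ps2 P (kob X ⊗ kob Y) (kob Z))
    ∘ ((fmap (psfun P d b) (p ⊠ q) ∘ ps2 P (kob X) (kob Y))
       ⊠ fmap (psfun P b a) r)
  = fmap (psfun P d a) (p ⊠ q ⊠ r) ∘ ps2 P (kob X) (kob Y ⊗ kob Z)
    ∘ (fmap (psfun P d c) p
       ⊠ (fmap (psfun P c a) (q ⊠ r) ∘ ps2 P (kob Y) (kob Z)))
    ∘ ((fmap (psfun P d c) p ⊠ fmap (psfun P c b) q ⊠ fmap (psfun P b a) r)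
       ∘ bassoc (psfun P d c (kob X)) (psfun P c b (kob Y))
           (psfun P b a (kob Z))).
Proof.
have -> : (fmap (psfun P d b) (p ⊠ q) ∘ ps2 P (kob X) (kob Y))
    ⊠ fmap (psfun P b a) r
    = (fmap (psfun P d b) (p ⊠ q) ⊠ fmap (psfun P b a) r)
      ∘ (ps2 P (kob X) (kob Y) ⊠ idm _) by rewrite -btensm_comp compm1.
have -> : fmap (psfun P d c) p
    ⊠ (fmap (psfun P c a) (q ⊠ r) ∘ ps2 P (kob Y) (kob Z))
    = (fmap (psfun P d c) p ⊠ fmap (psfun P c a) (q ⊠ r))
      ∘ (idm _ ⊠ ps2 P (kob Y) (kob Z)) by rewrite -btensm_comp compm1.
have pp : p ∘ p = p by exact: esym (kprojP _).
have qq : q ∘ q = q by exact: esym (kprojP _).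
have rr : r ∘ r = r by exact: esym (kprojP _).
have QQ : fmap (psfun P d a) (p ⊠ q ⊠ r) ∘ fmap (psfun P d a) (p ⊠ q ⊠ r)
    = fmap (psfun P d a) (p ⊠ q ⊠ r).
  by rewrite -fmap_comp -!btensm_comp pp qq rr.
have SS : fmap (psfun P d a) ((p ⊠ q) ⊠ r) ∘ fmap (psfun P d a) ((p ⊠ q) ⊠ r)
    = fmap (psfun P d a) ((p ⊠ q) ⊠ r).
  by rewrite -fmap_comp -!btensm_comp pp qq rr.
have n1 := ps2_nat P (p ⊠ q) r; have n2 := ps2_nat P p (q ⊠ r).
have n3 : (idm _ ⊠ ps2 P (kob Y) (kob Z))
      ∘ (fmap (psfun P d c) p ⊠ fmap (psfun P c b) q ⊠ fmap (psfun P b a) r)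
    = (fmap (psfun P d c) p ⊠ fmap (psfun P c a) (q ⊠ r))
      ∘ (idm _ ⊠ ps2 P (kob Y) (kob Z)).
  by rewrite -!btensm_comp comp1m compm1 ps2_nat.
have n4 : fmap (psfun P d a) (bassoc (kob X) (kob Y) (kob Z))
      ∘ fmap (psfun P d a) ((p ⊠ q) ⊠ r)
    = fmap (psfun P d a) (p ⊠ q ⊠ r)
      ∘ fmap (psfun P d a) (bassoc (kob X) (kob Y) (kob Z)).
  by rewrite -!fmap_comp bassoc_nat.
have GG : (fmap (psfun P d c) p ⊠ fmap (psfun P c a) (q ⊠ r))
      ∘ (fmap (psfun P d c) p ⊠ fmap (psfun P c a) (q ⊠ r))
    = fmap (psfun P d c) p ⊠ fmap (psfun P c a) (q ⊠ r).
  by rewrite -btensm_comp -!fmap_comp pp -btensm_comp qq rr.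
rewrite fmap_comp.
exact: (projected_square n1 n2 n3 n4 QQ SS GG (ps2_assoc P _ _ _)).
Qed.

Definition completion_semipseudo : semipseudo (completion E) (completion F).
Proof.
refine (@SemiPseudo (completion E) (completion F) P
  (fun b a => kar_functor (psfun P b a)) kar2 _ _).
- move=> c b a X X' Y Y' f g; apply: karhom_eq => /=.
  rewrite -compA ps2_nat compA -fmap_comp -btensm_comp !karhomPl.
  by rewrite compA -fmap_comp -btensm_comp !karhomPr; exact: erefl.
- by move=> d c b a X Y Z; apply: karhom_eq; exact: kar2_assoc.
Defined.

End CompletionPseudo.

(** * Units of the completion under transport *)

Section TransportUnits.
Variables (A : strictcat) (K : Type) (M M' : K -> frobmonad A).
Variable t : forall b, monad_iso (M b) (M' b).
Variables (s : forall b, splitting (M b)) (s' : forall b, splitting (M' b)).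
Implicit Types (X Y : lfun A) (Z : A) (a b c : K).

Lemma transport_comp b a X Y S (g : bimor (M b) (M a) Y S)
    (f : bimor (M b) (M a) X Y) Z :
  transport (t b) (t a) (bimor_comp g f) Z
  = transport (t b) (t a) g Z ∘ transport (t b) (t a) f Z.
Proof. exact: conj_comp (sandwichK (t b) (t a) Y Z). Qed.

Lemma mu_sandwichV b Z :
  mu (M b) Z ∘ sandwichV (t b) (t b) (lid A) Z = miV (t b) Z ∘ mu (M' b) Z.
Proof. by rewrite miV_mu miV_nat. Qed.

Definition transported_unit b : bimor (M' b) (M' b) (lid A) (lid A) :=
  transport (t b) (t b) (unit_proj s b).

(** Like [sec ∘ mu], the transported idempotent is a section of [mu (M' b)] preceded by [mu (M' b)].
    Any two such idempotents absorb each other, so the unit 1-arrows of [s] and [s'] are isomorphic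
    although the two splittings are unrelated. *)
Lemma mu_transported_unit b Z :
  mu (M' b) Z ∘ transported_unit b Z = mu (M' b) Z.
Proof.
have eu : mu (M' b) Z ∘ sandwich (t b) (t b) (lid A) Z
    = mi (t b) Z ∘ mu (M b) Z by rewrite (mi_mu (t b)).
move: eu (mu_sandwichV b Z); rewrite /=.
move: (sandwich _ _ _ _) (sandwichV _ _ _ _) => u v eu ev.
rewrite !compA eu -(compA (mi _ _) (mu _ _)) mu_sec compm1 -compA ev compA.
by rewrite miVK comp1m.
Qed.

Lemma transported_unitE b Z : transported_unit b Z
  = sandwich (t b) (t b) (lid A) Z ∘ sec (s b) Z ∘ miV (t b) Z ∘ mu (M' b) Z.
Proof.
rewrite -(compA _ (miV _ _)) -mu_sandwichV /=.
by move: (sandwich _ _ _ _) (sandwichV _ _ _ _) => u v; rewrite !compA.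
Qed.

Lemma transported_unitr b Z :
  transported_unit b Z ∘ (sec (s' b) Z ∘ mu (M' b) Z) = transported_unit b Z.
Proof.
by rewrite transported_unitE -!compA (compA (mu _ _)) mu_sec comp1m.
Qed.

Lemma transported_unitl b Z :
  sec (s' b) Z ∘ mu (M' b) Z ∘ transported_unit b Z
  = sec (s' b) Z ∘ mu (M' b) Z.
Proof. by rewrite -compA mu_transported_unit. Qed.

(** Transport turns the action of [M b] into that of [M' b] once the middle factor is converted;
    this is the unit coherence before projections are inserted. *)
Lemma transport_actl b a X Z :
  transport (t b) (t a) (actl (M b) (M a) X) Z
    ∘ emo (M' b) (miV (t b) (X (M' a Z)))
  = mu (M' b) (X (M' a Z)).
Proof.
have e : sandwichV (t b) (t a) (lcomp (lid A) (lcomp (M b) X)) Z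
      ∘ emo (M' b) (miV (t b) (X (M' a Z)))
    = emo (M b) (sandwichV (t b) (t a) X Z) ∘ miV (t b) (M' b (X (M' a Z))).
  by rewrite /sandwichV /= -compA miV_nat !emo_comp !compA.
have m := sandwich_mul (t b) (t a) X Z.
have k : emo (M b) (sandwich (t b) (t a) X Z)
    ∘ emo (M b) (sandwichV (t b) (t a) X Z) = idm _.
  by rewrite -emo_comp sandwichVK emo_id.
move: m e k; rewrite /=.
move: (emo _ (sandwich _ _ _ _)) (emo _ (sandwichV _ _ _ _)).
move: (sandwich _ _ _ _) (sandwichV _ _ _ _) => u v u' v' m e k.
rewrite -(compA (u ∘ _)) e m -(compA (mu _ _)) -(compA (mi _ _)) (compA u') k.
by rewrite comp1m miVK compm1.
Qed.

Lemma transport_actr c b X Z :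
  transport (t c) (t b) (actr (M c) (M b) X) Z
    ∘ emo (M' c) (emo X (miV (t b) (M' b Z)))
  = emo (M' c) (emo X (mu (M' b) Z)).
Proof.
have e : sandwichV (t c) (t b) (lcomp X (lcomp (M b) (lid A))) Z
      ∘ emo (M' c) (emo X (miV (t b) (M' b Z)))
    = emo (M c) (emo X (miV (t b) (M b Z) ∘ emo (M' b) (miV (t b) Z)))
      ∘ miV (t c) (X (M' b (M' b Z))).
  rewrite /sandwichV /= -compA miV_nat compA -!emo_comp.
  by rewrite (miV_nat (t b) (miV (t b) Z)).
rewrite -[transport _ _ _ _]/(_ ∘ _ ∘ _) -!(compA _ (sandwichV _ _ _ _)) e.
rewrite /= /sandwich -!compA (compA (emo (M c) _) (emo (M c) _)) -!emo_comp.
rewrite (compA (emo (M c) _) (emo (M c) _)) -!emo_comp.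
rewrite -(compA (mi _ _) (mu _ _)) -miV_mu (compA (mi (t b) _)) miVK comp1m.
by rewrite compA mi_nat -compA miVK compm1.
Qed.

Lemma transport_lunitE b a X (p : bimor (M b) (M a) X X) Z :
  (forall W, p W ∘ p W = p W) ->
  transport (t b) (t a) (bimor_comp p (actl (M b) (M a) X)) Z
    ∘ (transport (t b) (t a) (bimor_tens (unit_proj s b) p) Z
       ∘ emo (M' b) (miV (t b) (X (M' a Z))))
    ∘ (transported_unit b (X (M' a Z)) ∘ emo (M' b) (transport (t b) (t a) p Z))
  = transport (t b) (t a) p Z ∘ mu (M' b) (X (M' a Z)).
Proof.
move=> pp.
(* The action absorbs the tensored projections already before transport, where [mu_sec] for [M b] is
   at hand. *)
have e : bimor_comp (bimor_comp p (actl (M b) (M a) X))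
    (bimor_tens (unit_proj s b) p) = bimor_comp p (actl (M b) (M a) X).
  apply: bimor_eq => W /=.
  rewrite -!compA (compA (mu _ _) (sec _ _)) mu_sec comp1m -bfam_modl compA.
  by rewrite pp.
have P2 : transport (t b) (t a) p Z ∘ transport (t b) (t a) p Z
    = transport (t b) (t a) p Z.
  rewrite -transport_comp; congr (bfam (transport _ _ _) Z).
  exact: bimor_eq.
rewrite (compA (bfam _ _) (bfam _ _)) -transport_comp e transport_comp.
rewrite -!(compA (transport _ _ p _)) transport_actl.
rewrite (compA (mu _ _)) mu_transported_unit -bfam_modl.
by rewrite (compA (transport _ _ p _)) P2.
Qed.

Lemma transport_runitE c b X (p : bimor (M c) (M b) X X) Z :
  (forall W, p W ∘ p W = p W) ->
  transport (t c) (t b) (bimor_comp p (actr (M c) (M b) X)) Z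
    ∘ (transport (t c) (t b) (bimor_tens p (unit_proj s b)) Z
       ∘ emo (M' c) (emo X (miV (t b) (M' b Z))))
    ∘ (transport (t c) (t b) p (M' b Z)
       ∘ emo (M' c) (emo X (transported_unit b Z)))
  = transport (t c) (t b) p Z ∘ emo (M' c) (emo X (mu (M' b) Z)).
Proof.
move=> pp.
have e : bimor_comp (bimor_comp p (actr (M c) (M b) X))
    (bimor_tens p (unit_proj s b)) = bimor_comp p (actr (M c) (M b) X).
  apply: bimor_eq => W /=.
  rewrite -!compA (compA (emo _ _) (bfam _ _)) -bfam_modr -!compA.
  by rewrite -!emo_comp compA (compA (mu _ _)) mu_sec comp1m pp.
have P2 : transport (t c) (t b) p Z ∘ transport (t c) (t b) p Z
    = transport (t c) (t b) p Z.
  rewrite -transport_comp; congr (bfam (transport _ _ _) Z).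
  exact: bimor_eq.
rewrite (compA (bfam _ _) (bfam _ _)) -transport_comp e transport_comp.
rewrite -!(compA (transport _ _ p _)) transport_actr.
rewrite (compA (emo _ _)) -bfam_modr -!(compA (transport _ _ p _)) -!emo_comp.
by rewrite mu_transported_unit (compA (transport _ _ p _)) P2.
Qed.

End TransportUnits.

Section TransportPseudo.
Variables (A : strictcat) (K : Type) (M M' : K -> frobmonad A).
Variable t : forall b, monad_iso (M b) (M' b).
Variables (s : forall b, splitting (M b)) (s' : forall b, splitting (M' b)).
Local Notation E := (@Bicat (completion (bimbicat M)) (completion_unit s)).
Local Notation E' := (@Bicat (completion (bimbicat M')) (completion_unit s')).
Local Notation P := (completion_semipseudo (transport_semipseudo t)).

Definition transport_unit b :
  @iso (@bhom E' b b) (unitarr s' b) (psfun P b b (unitarr s b)).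
Proof.
refine (@Iso (@bhom E' b b) (unitarr s' b) (psfun P b b (unitarr s b))
  (@kbimor _ _ M' b b (unitarr s' b) (psfun P b b (unitarr s b))
    (transported_unit t s b) (@kprojK _ _ M' b b (psfun P b b (unitarr s b)))
    (transported_unitr t s s' b))
  (@kbimor _ _ M' b b (psfun P b b (unitarr s b)) (unitarr s' b)
    (unit_proj s' b) (@kprojK _ _ M' b b (unitarr s' b))
    (transported_unitl t s s' b)) _ _).
- refine (@kbimor_eq _ _ M' b b _ _ _ _ _) => Z.
  exact: (transported_unitl t s s' b Z).
- refine (@kbimor_eq _ _ M' b b _ _ _ _ _) => Z.
  exact: (transported_unitr t s s' b Z).
Defined.

Definition transport_pseudo : pseudo E E'.
Proof.
refine (@Pseudo E E' P transport_unit _ _).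
- move=> b a X.
  refine (@kbimor_eq _ _ M' b a _ _ _ _ _) => Z.
  exact: (transport_lunitE t s Z (kprojK X)).
- move=> c b X.
  refine (@kbimor_eq _ _ M' c b _ _ _ _ _) => Z.
  exact: (transport_runitE t s Z (kprojK X)).
Defined.

Lemma transport_bicat : bicat_isomorphic E E'.
Proof.
exists transport_pseudo; split; first by exists id.
move=> b a; exact/kar_functor_iso/transport_iso.
Qed.

End TransportPseudo.

(** * From isomorphic algebras to isomorphic monads *)

Section FrobeniusIsomorphism.
Variables (A : strictcat) (F G : frobenius A) (s : iso (fr_ob F) (fr_ob G)).
Hypothesis sW' : s ∘ fr_W' F = fr_W' G ∘ (s ⊠ s).

Definition frobmon_iso : monad_iso (frobmon F) (frobmon G).
Proof.
refine (@MonadIso A (frobmon F) (frobmon G) (fun Z => s ⊠ idm Z)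
  (fun Z => bwd s ⊠ idm Z) _ _ _ _ _) => [Z W|Z W|Z|Z|Z].
- by rewrite tensmA tensm_id.
- by rewrite tensmA tensm_id.
- by rewrite -tensm_comp bwdK comp1m tensm_id.
- by rewrite -tensm_comp fwdK comp1m tensm_id.
- apply: (rep_eq (f := s ∘ fr_W' F) (g := fr_W' G ∘ (s ⊠ s))) _ _ _;
    last by rewrite sW'.
    by apply: rep_comp (mu_frobmon F Z) _.
  apply: rep_comp _ (mu_frobmon G Z).
  by rewrite -tensm_comp compm1 comp1m tensmA.
Defined.

Definition idmonad_iso : monad_iso (idmonad A) (idmonad A).
Proof.
by refine (@MonadIso A (idmonad A) (idmonad A) (fun Z => idm Z)
  (fun Z => idm Z) (strong_idm (lid A)) (strong_idm (lid A)) _ _ _) => Z /=;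
  rewrite !comp1m.
Defined.

Definition abmonad_iso b :
    monad_iso (abmonad (frobmon F) b) (abmonad (frobmon G) b) :=
  match b return monad_iso (abmonad (frobmon F) b) (abmonad (frobmon G) b) with
  | true => idmonad_iso
  | false => frobmon_iso
  end.

End FrobeniusIsomorphism.

Theorem proposition5p20 (R : realType) (A : tensor_cstar R)
    (Aproj : closed_under_projections A)
    (Asum : closed_under_direct_sums A)
    (Aconj : closed_under_conjugation A) :
  exists E0 : forall F : frobenius A, associated_a2cat F,
  (forall F G : frobenius A,
      frob_isomorphic F G -> a2_isomorphic (E0 F) (E0 G)) /\
  exists U : forall F : frobenius A, star_frobenius F ->
      forall a : completion (E0 F), unit_at a,
  (forall (F : frobenius A) (hF : star_frobenius F),
    let E := completion_bicat (U F hF) in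
    let oA : E := as_A (E0 F) in
    let oB : E := as_B (E0 F) in
    (* (1) *)
    (oA <> oB /\ forall c : E, c = oA \/ c = oB) /\
    (exists I : tensor_functor A (HOM oA),
      (* (2) *)
      (fully_faithful I /\
       forall Y : HOM oA, exists X : A, retract Y (I X)) /\
      (* (3) *)
      (exists (rho : bhom oB oA) (rhob : bhom oA oB)
          (e : mor (uarr (bunit oB)) (btens rho rhob))
          (eps : mor (uarr (bunit oA)) (btens rhob rho))
          (d : mor (btens rhob rho) (uarr (bunit oA)))
          (eta : mor (btens rho rhob) (uarr (bunit oB))),
        conjugation_relations e eps d eta /\
        (* (4) *)
        (is_frobenius (conjugation_frobdata e eps d eta) /\
         frob_image I F = conjugation_frobdata e eps d eta))) /\
    (exists pa : preadditive E,
      (* (5) *)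
      (forall (b a : E) (X Y : bhom b a) (f g : mor X Y),
         sval (pa_add pa f g) = l2_lin (as_lin (E0 F)) 1%R (sval f) (sval g)) /\
      (* (6) *)
      has_direct_sums2 pa)) /\
  (forall (F G : frobenius A) (hF : star_frobenius F) (hG : star_frobenius G),
    frob_isomorphic F G ->
    bicat_isomorphic (completion_bicat (U F hF)) (completion_bicat (U G hG))).
Proof.
exists (@ab_associated R A); split.
  move=> F G [s [_ _ _ sW']].
  exists (transport_semipseudo (@abmonad_iso (strictcat_of A) F G s sW')).
  exact: transport_semipseudo_iso.
exists (@ab_unit R A); split; last first.
  move=> F G hF hG [s [_ _ _ sW']].
  exact: (transport_bicat (@abmonad_iso (strictcat_of A) F G s sW')
    (absplitting hF) (absplitting hG)).
move=> F hF E oA oB; split; first by split=> // -[]; [left|right].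
pose s := absplitting hF; split.
  exists (kembed s); split.
    split; [exact: (kembed_fully_faithful s)|exact: (@kembed_retract _ _ s)].
  exists (rho s), (rhob s), (e_rho s), (eps_rho s), (d_rho s), (eta_rho s).
  split; first exact: (rho_conjugation s).
  rewrite [conjugation_frobdata _ _ _ _](conjugation_frobdataE s).
  split; first exact: (rho_frobenius s).
  exact: (@frob_image_kembed (strictcat_of A) F s).
exists (completion_preadditive s); split; last exact: has_direct_sums.
(* Sums of 2-arrows are componentwise in both bicategories, so the two additions agree. *)
move=> b a X Y f g.
exact: (esym (@ab_l2_lin R A (frobmon_of F) b a (kob X) (kob Y) 1%R
  (sval f) (sval g))).
Qed.
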